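(* Let $\alpha>1$. There is a constant $C$ depending only on $\alpha$ such that the following holds for every sequence of integers $0<n_1<n_2<\dots<n_J$ with $n_{j+1}/n_j\ge\alpha$ for all $1\le j<J$ (the constant $C$ being independent of $J$). Put $\mathscr C_{\mathrm{lac}}f=\sup_{j}|S_{n_j}f|$. For every $t>0$, every measurable set $F\subset[0,1]$, and every measurable $f$ on $[0,1]$ majorized by $F$, we have $$(\mathscr C_{\mathrm{lac}}f)^{*}(t)\le C\,\frac{|F|}{t}\,\log\log_+\Bigl(\frac{t}{|F|}\Bigr).$$
   Context: Walsh system on $[0,1]$: $W_0\equiv1$, and for $n\ge1$ with binary expansion $n=\sum_{k=0}^r\varepsilon_k2^k$ ($\varepsilon_k\in\{0,1\}$), $W_n(x)=\prod_{k=0}^r\bigl(\operatorname{sign}\sin(2^{k+1}\pi x)\bigr)^{\varepsilon_k}$. For $f\in L^1[0,1]$, $\widehat f(k)=\int_0^1fW_k\,dx$ and $S_nf=\sum_{k=0}^n\widehat f(k)W_k$. ''$f$ is majorized by $F$'' means $|f|\le\mathbf 1_F$. $|E|$ is the Lebesgue measure of $E$. $\log_+x=27+\max(0,\log x)$ and $\log\log_+x=\log(\log_+x)$. When $|F|=0$ the right-hand side is interpreted as $0$. The decreasing rearrangement of a function $h$ on $[0,1]$ is $h^*(t)=\inf\{s\ge0:|\{x\in[0,1]:|h(x)|>s\}|\le t\}$, $t>0$. *)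

(* Defs.v *)
From HB Require Import structures.
From mathcomp Require Import all_boot all_order all_algebra.
From mathcomp Require Import all_classical all_reals all_analysis.
Set Implicit Arguments.
Unset Strict Implicit.
Unset Printing Implicit Defensive.
Import Order.TTheory GRing.Theory Num.Theory.
Import numFieldNormedType.Exports.
Local Open Scope classical_set_scope.
Local Open Scope ring_scope.

(* The real line with the sigma-algebra of Lebesgue measurable sets, as opposed
   to the default instance on R, whose measurable sets are the Borel sets. *)
Definition lebesgueType (R : realType) : measurableType _ :=
  caratheodory_type ((wlength (@idfun R))^*)%mu.

Notation lebmeas R := (@completed_lebesgue_measure R).

Definition unit_itv (R : realType) : set (lebesgueType R) := `[0 : R, 1 : R].
Arguments unit_itv : clear implicits.

Definition bindigit (n k : nat) : nat := odd (n %/ 2 ^ k).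

(* For n = 0 the range is k < 1 and the only digit is 0, so walsh 0 = 1. *)
Definition walsh (R : realType) (n : nat) (x : R) : R :=
  \prod_(k < (trunc_log 2 n).+1)
    Num.sg (sin (2 ^+ k.+1 * pi * x)) ^+ bindigit n k.

Definition walsh_coef (R : realType) (f : R -> R) (k : nat) : R :=
  \int[lebmeas R]_(x in unit_itv R) (f x * walsh k x).

Definition walsh_psum (R : realType) (n : nat) (f : R -> R) (x : R) : R :=
  \sum_(k < n.+1) walsh_coef f k * walsh k x.

Definition lacunary (R : realType) (alpha : R) (J : nat) (n : 'I_J -> nat) :=
  [/\ forall j, (0 < n j)%N,
      forall i j : 'I_J, (i < j)%N -> (n i < n j)%N
    & forall i j : 'I_J, j = i.+1 :> nat -> alpha <= (n j)%:R / (n i)%:R].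

(* The terms are nonnegative, so for J > 0 starting the maximum from 0 does not
   change its value. *)
Definition lac_maximal (R : realType) (J : nat) (n : 'I_J -> nat)
    (f : R -> R) (x : R) : R :=
  \big[Num.max/0]_(j < J) `|walsh_psum (n j) f x|.

(* Taken in the extended reals, so that the infimum of the empty set is +oo. *)
Definition rearrangement (R : realType) (h : R -> R) (t : R) : \bar R :=
  ereal_inf [set s%:E | s in [set s : R | 0 <= s /\
    (lebmeas R [set x | unit_itv R x /\ (s < `|h x|)%R] <= t%:E)%E]].

Definition majorized (R : realType) (f : R -> R) (F : set R) :=
  forall x, unit_itv R x -> `|f x| <= \1_F x.

Definition log_plus (R : realType) (x : R) : R := 27%:R + Num.max 0 (ln x).

Definition loglog_plus (R : realType) (x : R) : R := ln (log_plus x).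

(* Main.v *)
Require Import Defs.
From HB Require Import structures.
From mathcomp Require Import all_boot all_order all_algebra.
From mathcomp Require Import all_classical all_reals all_analysis.
From mathcomp Require Import measurable_realfun zify ring lra.
Set Implicit Arguments.
Unset Strict Implicit.
Unset Printing Implicit Defensive.
Import Order.TTheory GRing.Theory Num.Theory.
Import numFieldNormedType.Exports.
Local Open Scope classical_set_scope.
Local Open Scope ring_scope.

(* Partial sums of order below 2^N only see the averages of f over the dyadic
   intervals of length 2^-N, so everything takes place on bit strings of length
   N.  By the pigeonhole principle one may assume that the orders n_j lie in
   distinct dyadic blocks.

   Let P = |F|, th = 4 P / t and stop at the maximal dyadic intervals Q on which
   F has density > th; they cover at most t / 4.  Outside them, S_n f does not
   change when f is replaced on each Q by [good] + [bad n], where [good] is the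
   average of f over Q, and [bad n] is the component of f along the Walsh
   function W_n on Q, unless W_n is constant on Q.  The function [good] is
   bounded by 2 th, and its lacunary maximal function is controlled in L^2 by
   orthogonality.  Next, W_n S_n ([bad n]) is a martingale transform of
   W_n [bad n], which is bounded by 2 th, so that the tails of S_n ([bad n])
   decay exponentially, with a gain of the squared L^2 norm of [bad n].
   Lacunary Walsh sums being subgaussian, the coefficients of f on Q along
   distinct blocks have square sum O(th^2 log_+(t / P)^2); thus only
   polylogarithmically many values of n matter, and this logarithmic number costs
   a factor loglog_+(t / P) against the exponential decay. *)

(** * Averages over the bit strings of a given length *)

Section Average.
Context {R : realType}.
Implicit Types (f g : seq bool -> R) (N : nat) (x : seq bool).

Definition child f (b : bool) : seq bool -> R := fun x => f (b :: x).

(** Splitting off the first bit is passing to the two halves of a dyadic interval, so that induction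
    on [N] is induction along the dyadic tree. *)
Fixpoint avg N f : R :=
  if N is N'.+1 then (avg N' (child f false) + avg N' (child f true)) / 2
  else f [::].

Lemma avgS N f :
  avg N.+1 f = (avg N (child f false) + avg N (child f true)) / 2.
Proof. by []. Qed.

Lemma eq_avg N f g : (forall x, size x = N -> f x = g x) -> avg N f = avg N g.
Proof.
elim: N f g => [|N IH] f g fg /=; first exact: fg.
by congr ((_ + _) / _); apply: IH => x sx; apply: fg; rewrite /= sx.
Qed.

Lemma le_avg N f g : (forall x, size x = N -> f x <= g x) ->
  avg N f <= avg N g.
Proof.
elim: N f g => [|N IH] f g fg /=; first exact: fg.
by rewrite ler_pM2r ?invr_gt0// lerD//; apply: IH => x sx;
  apply: fg; rewrite /= sx.
Qed.

Lemma avg_cst N (c : R) : avg N (fun=> c) = c.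
Proof.
elim: N => //= N IH.
by rewrite /child IH; field.
Qed.

Lemma avgD N f g : avg N (fun x => f x + g x) = avg N f + avg N g.
Proof.
elim: N f g => //= N IH f g.
by rewrite /child !IH -/(child f _) -/(child g _); field.
Qed.

Lemma avgZ N (c : R) f : avg N (fun x => c * f x) = c * avg N f.
Proof.
elim: N f => //= N IH f.
by rewrite /child !IH -/(child f _); field.
Qed.

Lemma avgZr N (c : R) f : avg N (fun x => f x * c) = avg N f * c.
Proof. by rewrite mulrC -avgZ; apply: eq_avg => x _; rewrite mulrC. Qed.

Lemma avgN N f : avg N (fun x => - f x) = - avg N f.
Proof. by rewrite -mulN1r -avgZ; apply: eq_avg => x _; rewrite mulN1r. Qed.

Lemma avg_sum N (I : Type) (r : seq I) (P : pred I) (F : I -> seq bool -> R) :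
  avg N (fun x => \sum_(i <- r | P i) F i x) = \sum_(i <- r | P i) avg N (F i).
Proof.
elim: r => [|i r IH].
  by rewrite big_nil -[RHS](avg_cst N); apply: eq_avg => x _; rewrite big_nil.
rewrite big_cons; case: ifPn => Pi.
  by rewrite -IH -avgD; apply: eq_avg => x _; rewrite big_cons Pi.
by rewrite -IH; apply: eq_avg => x _; rewrite big_cons (negbTE Pi).
Qed.

Lemma avg_ge0 N f : (forall x, size x = N -> 0 <= f x) -> 0 <= avg N f.
Proof. by move=> f0; rewrite -[leLHS](avg_cst N); exact: le_avg. Qed.

Lemma ler_norm_avg N f : `|avg N f| <= avg N (fun x => `|f x|).
Proof.
rewrite ler_norml -avgN; apply/andP; split; apply: le_avg => x _.
  by rewrite lerNl -normrN ler_norm.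
exact: ler_norm.
Qed.

End Average.

(** * Walsh functions, coefficients and partial sums on bit strings *)

Section Walsh.
Context {R : realType}.
Implicit Types (f g : seq bool -> R) (N n : nat) (x : seq bool).

(* The first bit of [x], which is the first binary digit of a point of [0, 1],
   is paired with the lowest binary digit of [n]. *)
Fixpoint wal n x : R :=
  if x is b :: x' then (-1) ^+ (b && odd n) * wal n./2 x' else 1.

Lemma wal0 x : wal 0 x = 1.
Proof. by elim: x => //= b x IH; rewrite andbF expr0 mul1r. Qed.

Lemma wal_sqr n x : wal n x * wal n x = 1.
Proof.
elim: x n => [|b x IH] n /=; first by rewrite mulr1.
by rewrite mulrACA IH mulr1 -expr2 sqrr_sign.
Qed.

Lemma normr_wal n x : `|wal n x| = 1.
Proof.
by elim: x n => [|b x IH] n /=; rewrite ?normr1// normrM IH normr_sign mulr1.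
Qed.

Definition wcoef N f n : R := avg N (fun x => f x * wal n x).

Lemma wcoefS N f n : wcoef N.+1 f n =
  (wcoef N (child f false) n./2 + (-1) ^+ odd n * wcoef N (child f true) n./2) / 2.
Proof.
rewrite {1}/wcoef /=; congr ((_ + _) / 2); first by
  apply: eq_avg => x _; rewrite /child /= expr0 mul1r.
by rewrite -avgZ; apply: eq_avg => x _; rewrite /child /= mulrCA.
Qed.

Lemma wcoef0 N f : wcoef N f 0 = avg N f.
Proof. by apply: eq_avg => x _; rewrite wal0 mulr1. Qed.

(** The index [n] is excluded, whereas [walsh_psum n] includes it: with this convention orders can
    be halved, and those that are powers of 2 give conditional expectations. *)
Definition psum N n f x : R := \sum_(k < n) wcoef N f k * wal k x.

(** The functions of index 2k and 2k+1 both restrict to [wal k] on the first half, and to opposite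
    signs of it on the second, so their two terms add up to the local term on the half that contains
    the point. *)
Lemma psum_double N m f b x :
  psum N.+1 m.*2 f (b :: x) = psum N m (child f b) x.
Proof.
elim: m => [|m IH]; first by rewrite /psum !big_ord0.
rewrite /psum doubleS !big_ord_recr /= -/(psum N.+1 m.*2 f (b :: x)) IH -addrA.
rewrite -/(psum N m (child f b) x); congr (_ + _).
rewrite !wcoefS /= odd_double /= uphalf_double doubleK.
rewrite andbF andbT expr0 !mul1r expr1.
by case: (b) => /=; rewrite ?expr1 ?expr0; field.
Qed.

(** For odd [n] one term is left over, of even index [n - 1], whose Walsh function is the same on
    both halves. This recursion drives the inductions of [psum_bellman] and [psum_good_bad]. *)
Lemma psumS N n f b x : psum N.+1 n f (b :: x) = psum N n./2 (child f b) x +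
  (odd n)%:R * ((wcoef N (child f false) n./2 + wcoef N (child f true) n./2) / 2
   * wal n./2 x).
Proof.
rewrite -[in LHS](odd_double_half n); case: (odd n); last first.
  by rewrite add0n psum_double mul0r addr0.
rewrite add1n mul1r /psum big_ord_recr /= -/(psum N.+1 n./2.*2 f (b :: x)).
rewrite psum_double wcoefS /=.
by rewrite odd_double /= doubleK andbF expr0 !mul1r.
Qed.

Lemma psum0 N f x : psum N 0 f x = 0.
Proof. by rewrite /psum big_ord0. Qed.

Lemma wcoefD N f g n : wcoef N (fun x => f x + g x) n = wcoef N f n + wcoef N g n.
Proof. by rewrite /wcoef -avgD; apply: eq_avg => x _; rewrite mulrDl. Qed.

Lemma psumD N n f g x :
  psum N n (fun x => f x + g x) x = psum N n f x + psum N n g x.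
Proof.
by rewrite /psum -big_split; apply: eq_bigr => i _ /=; rewrite wcoefD mulrDl.
Qed.

Lemma wcoefZ N c f n : wcoef N (fun x => c * f x) n = c * wcoef N f n.
Proof. by rewrite /wcoef -avgZ; apply: eq_avg => x _; rewrite mulrA. Qed.

Lemma psumZ N n c f x : psum N n (fun x => c * f x) x = c * psum N n f x.
Proof.
by rewrite /psum mulr_sumr; apply: eq_bigr => i _ /=; rewrite wcoefZ mulrA.
Qed.

Lemma eq_psum N n f g x : (forall x, size x = N -> f x = g x) ->
  psum N n f x = psum N n g x.
Proof.
move=> fg; apply: eq_bigr => i _; congr (_ * _).
by apply: eq_avg => y /fg ->.
Qed.

Lemma ler_norm_wcoef N f n : `|wcoef N f n| <= avg N (fun x => `|f x|).
Proof.
apply: le_trans (ler_norm_avg _ _) _; apply: le_avg => x _.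
by rewrite normrM normr_wal mulr1.
Qed.

(** Halving the order [i] times leaves order 1, that is, the mean over a dyadic interval of length
    [2^-i]. *)
Lemma psum_pow2_bound N i f x (B : R) : (i <= N)%N -> size x = N ->
  (forall y, size y = N -> `|f y| <= B) -> `|psum N (2 ^ i) f x| <= B.
Proof.
elim: i N f x => [|i IH] N f x iN sx fB.
  rewrite /psum big_ord_recr big_ord0 /= add0r wal0 mulr1.
  apply: le_trans (ler_norm_wcoef _ _ _) _.
  by rewrite -[leRHS](avg_cst N); exact: le_avg.
case: N x iN sx fB => [|N] [|b x] //= iN [sx] fB.
rewrite expnS mul2n psum_double; apply: IH => // y sy.
by apply: fB; rewrite /= sy.
Qed.

Lemma avg_wal_mul N k l : (k < 2 ^ N)%N -> (l < 2 ^ N)%N ->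
  avg N (fun x => wal k x * wal l x) = (k == l)%:R.
Proof.
elim: N k l => [|N IH] k l.
  by rewrite expn0 !ltnS !leqn0 => /eqP -> /eqP ->; rewrite /= mulr1.
rewrite expnS mul2n -!ltn_half_double => kN lN.
have := wcoefS N (wal k) l; rewrite {1}/wcoef => ->.
have E b : wcoef N (child (wal k) b) l./2 =
    (-1) ^+ (b && odd k) * (k./2 == l./2)%:R.
  by rewrite -(IH _ _ kN lN) -avgZ; apply: eq_avg => x _; rewrite mulrA.
rewrite !E /= expr0 mul1r.
have -> : (k == l) = (odd k == odd l) && (k./2 == l./2).
  apply/eqP/andP => [->//|[/eqP ko /eqP kh]].
  by rewrite -(odd_double_half k) -(odd_double_half l) ko kh.
by case: (odd k) (odd l) => [] [] /=; rewrite ?expr0 ?expr1; field.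
Qed.

End Walsh.

Arguments wcoef {R} N f n : simpl never.

(** * Orthogonality and square sums of lacunary differences *)

Section Orthogonality.
Context {R : realType}.
Implicit Types (f : seq bool -> R) (N n : nat).

Lemma avg_sqr_wal_sum N m n (c : nat -> R) : (n <= 2 ^ N)%N ->
  avg N (fun x => (\sum_(m <= k < n) c k * wal k x) ^+ 2) =
  \sum_(m <= k < n) c k ^+ 2.
Proof.
move=> nN.
under eq_avg do rewrite expr2 big_distrlr.
rewrite avg_sum big_nat_cond [RHS]big_nat_cond; apply: eq_bigr => i.
rewrite andbT => /andP[mi ni].
rewrite avg_sum (bigD1_seq i) ?mem_index_iota ?mi ?iota_uniq//=.
have E j : (j < n)%N -> avg N (fun x => c i * wal i x * (c j * wal j x)) =
    c i * c j * (i == j)%:R.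
  move=> jn; rewrite -(@avg_wal_mul R N i j) ?(leq_trans _ nN)// -avgZ.
  by apply: eq_avg => x _; rewrite mulrACA.
rewrite E// eqxx mulr1 -expr2 big_nat_cond big1 ?addr0// => j.
move=> /andP[/andP[mj nj] ji].
by rewrite E// eq_sym (negbTE ji) mulr0.
Qed.

Lemma bessel N f :
  \sum_(0 <= k < 2 ^ N) wcoef N f k ^+ 2 <= avg N (fun x => f x ^+ 2).
Proof.
have : 0 <= avg N (fun x =>
    (f x - \sum_(0 <= k < 2 ^ N) wcoef N f k * wal k x) ^+ 2).
  by apply: avg_ge0 => x _; exact: sqr_ge0.
have -> : avg N (fun x =>
    (f x - \sum_(0 <= k < 2 ^ N) wcoef N f k * wal k x) ^+ 2) =
  avg N (fun x => f x ^+ 2) +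
  ((- 2) * avg N (fun x =>
      \sum_(0 <= k < 2 ^ N) wcoef N f k * (f x * wal k x)) +
   avg N (fun x => (\sum_(0 <= k < 2 ^ N) wcoef N f k * wal k x) ^+ 2)).
  rewrite -avgZ -!avgD; apply: eq_avg => x _.
  under [in RHS]eq_bigr do rewrite mulrCA.
  by rewrite -mulr_sumr; ring.
rewrite avg_sqr_wal_sum// avg_sum.
under eq_bigr do rewrite avgZ -/(wcoef N f _) -expr2.
by move=> ?; lra.
Qed.

(** A total sequence, with an order in every block, is stable under passing to a half interval,
    where the blocks shift by one ([dyadic_family_half]). *)
Definition dyadic_family (nu : nat -> nat) :=
  forall i, (2 ^ i <= nu i < 2 ^ i.+1)%N.

Lemma dyadic_family0 nu : dyadic_family nu -> nu 0%N = 1%N.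
Proof. by move=> /(_ 0%N); rewrite expn0 expn1 ltnS -eqn_leq => /eqP. Qed.

Lemma dyadic_family_half nu : dyadic_family nu ->
  dyadic_family (fun i => (nu i.+1)./2).
Proof.
move=> Hnu i; have := Hnu i.+1; rewrite (expnS 2 i.+1) (expnS 2 i) !mul2n.
by rewrite ltn_half_double geq_half_double.
Qed.

Lemma psum_sub N m n f x : (m <= n)%N ->
  psum N n f x - psum N m f x = \sum_(m <= k < n) wcoef N f k * wal k x.
Proof.
move=> mn; rewrite /psum -!(big_mkord xpredT (fun k => wcoef N f k * wal k x)).
by rewrite (@big_cat_nat _ _ _ m)//= addrAC subrr add0r.
Qed.

(** Each difference only involves frequencies of one dyadic block, and the blocks are disjoint, so
    Bessel's inequality handles all of them at once. *)
Lemma lacunary_square_sum N f nu : dyadic_family nu ->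
  \sum_(i < N) avg N (fun x => (psum N (nu i) f x - psum N (2 ^ i) f x) ^+ 2) <=
  avg N (fun x => f x ^+ 2).
Proof.
move=> Hnu; apply: le_trans (bessel N f).
have -> : \sum_(i < N)
    avg N (fun x => (psum N (nu i) f x - psum N (2 ^ i) f x) ^+ 2) =
  \sum_(i < N) \sum_(2 ^ i <= k < nu i) wcoef N f k ^+ 2.
  apply: eq_bigr => i _; have /andP[h1 h2] := Hnu i.
  rewrite -(@avg_sqr_wal_sum N); last first.
    by rewrite (leq_trans (ltnW h2))// leq_exp2l.
  by apply: eq_avg => x _; rewrite psum_sub.
suff H M : \sum_(i < M) \sum_(2 ^ i <= k < nu i) wcoef N f k ^+ 2 <=
    \sum_(0 <= k < 2 ^ M) wcoef N f k ^+ 2 by exact: H.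
elim: M => [|M IH]; first by rewrite big_ord0 sumr_ge0// => i _; rewrite sqr_ge0.
have /andP[h1 h2] := Hnu M.
have h0 : (2 ^ M <= 2 ^ M.+1)%N by rewrite leq_exp2l.
rewrite big_ord_recr /= [leRHS](@big_cat_nat _ _ _ (2 ^ M)%N)//= lerD//.
rewrite [leRHS](@big_cat_nat _ _ _ (nu M) (2 ^ M)%N)//= ?(ltnW h2)// lerDl.
by apply: sumr_ge0 => i _; rewrite sqr_ge0.
Qed.

End Orthogonality.

(** * Exponential estimates for partial sums and for lacunary sums *)

Section Exponential.
Context {R : realType}.
Implicit Types (f : seq bool -> R) (N n : nat).

(** From [expR (- u) >= 1 - u] one gets [expR u * (1 - u) <= 1], while the right-hand side times
    [1 - u] is at least 1. *)
Lemma expR_le_quad (u : R) : u <= 2^-1 -> expR u <= 1 + u + 2 * u ^+ 2.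
Proof.
move=> u2; have u1 : 0 < 1 - u by lra.
have h : expR u * (1 - u) <= 1.
  rewrite -[leRHS](expRxMexpNx_1 u) ler_pM2l ?expR_gt0//.
  exact: expR_ge1Dx.
rewrite -(ler_pM2r u1); apply: le_trans h _.
rewrite (_ : _ * (1 - u) = 1 + u ^+ 2 * (1 - 2 * u)); last by ring.
by rewrite lerDl mulr_ge0 ?sqr_ge0//; lra.
Qed.

(** Both variables move by steps of the same size [d]. Over the two branches the factor [2 - x ^+ 2]
    loses [2 * d ^+ 2] in total, which outweighs the remaining terms of order [d ^+ 2] because the
    rate [4^-1] is small. *)
Lemma bellman_step (x d : R) : `|x + d| <= 1 -> `|x - d| <= 1 ->
  expR (4^-1 * d) * (2 - (x + d) ^+ 2) + expR (4^-1 * - d) * (2 - (x - d) ^+ 2)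
  <= 2 * (2 - x ^+ 2).
Proof.
rewrite !ler_norml => /andP[a1 a2] /andP[b1 b2].
have e1 : expR (4^-1 * d) <= 1 + 4^-1 * d + 2 * (4^-1 * d) ^+ 2.
  by apply: expR_le_quad; lra.
have e2 : expR (4^-1 * - d) <= 1 + 4^-1 * - d + 2 * (4^-1 * - d) ^+ 2.
  by apply: expR_le_quad; lra.
have p1 : 0 <= 2 - (x + d) ^+ 2 by nra.
have p2 : 0 <= 2 - (x - d) ^+ 2 by nra.
apply: le_trans (lerD (ler_wpM2r p1 e1) (ler_wpM2r p2 e2)) _.
rewrite -subr_ge0 (_ : _ - _ =
   d ^+ 2 * (2 + x - 4^-1 * (2 - x ^+ 2 - d ^+ 2))); last by field.
apply: mulr_ge0; first exact: sqr_ge0.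
by nra.
Qed.

(* In Burkholder's manner: [wal n * psum n f] is the transform of the martingale
   of [f * wal n] by the binary digits of [n], and along it the function
   [(x, y) |-> expR (y / 4) * (2 - x ^+ 2)] is a supermartingale. *)
Lemma psum_bellman N n f (y : R) : (n < 2 ^ N)%N ->
  (forall x, size x = N -> `|f x| <= 1) ->
  avg N (fun x => expR (4^-1 * (y + wal n x * psum N n f x)) * (2 - f x ^+ 2))
  <= expR (4^-1 * y) * (2 - wcoef N f n ^+ 2).
Proof.
elim: N n f y => [|N IH] n f y.
  by rewrite expn0 ltnS leqn0 => /eqP -> _; rewrite /wcoef /= psum0 mulr0 addr0 mulr1.
rewrite expnS mul2n -ltn_half_double => nN f1.
have fb b x : size x = N -> `|child f b x| <= 1.
  by move=> sx; apply: f1; rewrite /= sx.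
have wb b : `|wcoef N (child f b) n./2| <= 1.
  apply: le_trans (ler_norm_wcoef _ _ _) _.
  by rewrite -[leRHS](avg_cst N); apply: le_avg => x; exact: fb.
(* On the second half [wal n] is [s * wal n./2], so the induction hypothesis is applied there to
   [s * child f true]. *)
pose s : R := (-1) ^+ odd n.
have IH0 (z : R) := IH n./2 (child f false) z nN (fb false).
have IH1 (z : R) : avg N (fun x => expR (4^-1 * (z + wal n./2 x *
    (s * psum N n./2 (child f true) x))) * (2 - child f true x ^+ 2)) <=
    expR (4^-1 * z) * (2 - wcoef N (child f true) n./2 ^+ 2).
  have := IH n./2 (fun x => s * child f true x) z nN.
  have ss : s ^+ 2 = 1 by rewrite sqrr_sign.
  rewrite wcoefZ exprMn ss mul1r => H.
  apply: le_trans (H _) => [|x sx]; last by rewrite normrM normr_sign mul1r fb.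
  by apply: le_avg => x _; rewrite psumZ exprMn ss mul1r.
move: IH0 IH1; rewrite wcoefS -/s.
have := wb false; have := wb true; rewrite /=.
set a0 := wcoef N (child f false) n./2; set a1 := wcoef N (child f true) n./2.
move=> a1B a0B IH0 IH1.
(* The leftover term of [psumS], without its Walsh factor: the increment of the martingale
   transform. *)
pose A : R := (odd n)%:R * ((a0 + a1) / 2).
have H0 : avg N (child (fun x => expR (4^-1 * (y + wal n x * psum N.+1 n f x)) *
     (2 - f x ^+ 2)) false) <= expR (4^-1 * (y + A)) * (2 - a0 ^+ 2).
  apply: le_trans (IH0 (y + A)); apply: le_avg => x _; rewrite /child psumS /=.
  rewrite -/a0 -/a1 expr0 mul1r -/(child f false).
  rewrite (_ : wal n./2 x * _ = A * (wal n./2 x * wal n./2 x) +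
     wal n./2 x * psum N n./2 (child f false) x); last by rewrite /A; ring.
  by rewrite wal_sqr mulr1 addrA.
have H1 : avg N (child (fun x => expR (4^-1 * (y + wal n x * psum N.+1 n f x)) *
     (2 - f x ^+ 2)) true) <= expR (4^-1 * (y + s * A)) * (2 - a1 ^+ 2).
  apply: le_trans (IH1 (y + s * A)); apply: le_avg => x _; rewrite /child psumS /=.
  rewrite -/a0 -/a1 -/s -/(child f true).
  rewrite (_ : s * wal n./2 x * _ = s * A * (wal n./2 x * wal n./2 x) +
     wal n./2 x * (s * psum N n./2 (child f true) x)); last by rewrite /A; ring.
  by rewrite wal_sqr mulr1 addrA.
rewrite ler_pdivrMr//; apply: le_trans (lerD H0 H1) _.
rewrite !(mulrDr 4^-1) !expRD -!mulrA -mulrDr ler_pM2l ?expR_gt0//.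
(* For odd [n] the martingale of [f * wal n] takes the values [a0] and [- a1] on the halves, at
   distance [(a0 + a1) / 2] from their midpoint. For even [n] the increment is 0 and convexity of
   the square suffices. *)
move: a0B a1B {H0 H1 IH0 IH1}; rewrite {}/A {}/s; case: (odd n) => /=.
- rewrite expr1 mul1r !mulN1r => a0B a1B.
  have := @bellman_step ((a0 - a1) / 2) ((a0 + a1) / 2).
  rewrite (_ : (a0 - a1) / 2 + (a0 + a1) / 2 = a0); last by field.
  rewrite (_ : (a0 - a1) / 2 - (a0 + a1) / 2 = - a1); last by field.
  by rewrite normrN sqrrN (mulrC _ 2) => /(_ a0B a1B).
- rewrite expr0 mul0r !mulr0 expR0 !mul1r => _ _.
  have := sqr_ge0 (a0 - a1); nra.
Qed.

(** The Bellman bounds for [f / B] and [- f / B] are both at most 2. Subtracting 2 from the sum of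
    the two exponentials cancels these constants and leaves twice the mean square of [f / B], a gain
    that makes the tails summable over [n]. *)
Lemma psum_tail N n f (B v : R) : (n < 2 ^ N)%N -> 0 < B ->
  (forall x, size x = N -> `|f x| <= B) ->
  (expR (4^-1 * (v / B)) - 2) * avg N (fun x => (v < `|psum N n f x|)%R%:R) <=
  2 * avg N (fun x => f x ^+ 2) / B ^+ 2.
Proof.
move=> nN B0 fB.
pose g x := B^-1 * f x.
have g1 x : size x = N -> `|g x| <= 1.
  by move=> /fB fx; rewrite normrM gtr0_norm ?invr_gt0// mulrC ler_pdivrMr// mul1r.
pose u x := wal n x * psum N n g x.
have g2 x : size x = N -> 1 <= 2 - g x ^+ 2.
  by move=> /g1; rewrite ler_norml => /andP[? ?]; nra.
have B1 : avg N (fun x => expR (4^-1 * u x) * (2 - g x ^+ 2)) <= 2.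
  have := @psum_bellman N n g 0 nN g1.
  rewrite mulr0 expR0 mul1r.
  under eq_avg do rewrite add0r.
  by move=> h; apply: le_trans h _; rewrite gerBl sqr_ge0.
have B2 : avg N (fun x => expR (- (4^-1 * u x)) * (2 - g x ^+ 2)) <= 2.
  have gN x : size x = N -> `| -1 * g x| <= 1 by rewrite mulN1r normrN; exact: g1.
  have := @psum_bellman N n (fun x => -1 * g x) 0 nN gN.
  rewrite mulr0 expR0 mul1r.
  under eq_avg do rewrite add0r psumZ !mulN1r sqrrN mulrN mulrN -/(u _).
  by move=> h; apply: le_trans h _; rewrite gerBl sqr_ge0.
have -> : 2 * avg N (fun x => f x ^+ 2) / B ^+ 2 = 2 * avg N (fun x => g x ^+ 2).
  rewrite -mulrA -avgZr; congr (_ * _); apply: eq_avg => x _.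
  by rewrite /g exprMn exprVn mulrC.
apply: (@le_trans _ _ (avg N (fun x =>
   (expR (4^-1 * u x) + expR (- (4^-1 * u x)) - 2) * (2 - g x ^+ 2)))).
  rewrite -avgZ; apply: le_avg => x sx.
  have cosh2 : 0 <= expR (4^-1 * u x) + expR (- (4^-1 * u x)) - 2.
    have := expR_ge1Dx (4^-1 * u x); have := expR_ge1Dx (- (4^-1 * u x)).
    by move=> *; lra.
  apply: (@le_trans _ _ ((expR (4^-1 * u x) + expR (- (4^-1 * u x)) - 2) * 1)).
    rewrite mulr1; case: ltP => [vx|_]; last by rewrite mulr0.
    rewrite mulr1 lerD2r.
    have : v / B <= `|u x|.
      rewrite ler_pdivrMr// /u normrM normr_wal mul1r psumZ normrM.
      by rewrite gtr0_norm ?invr_gt0// mulrAC mulVf ?gt_eqF// mul1r ltW.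
    rewrite -(@ler_pM2l _ 4^-1)// => h.
    apply: (@le_trans _ _ (expR (4^-1 * `|u x|)));
      first by rewrite ler_expR.
    case: (leP 0 (u x)) => u0; first by rewrite ger0_norm// lerDl expR_ge0.
    by rewrite ltr0_norm// mulrN lerDr expR_ge0.
  by rewrite ler_wpM2l// g2.
have -> : avg N (fun x =>
   (expR (4^-1 * u x) + expR (- (4^-1 * u x)) - 2) * (2 - g x ^+ 2)) =
  avg N (fun x => expR (4^-1 * u x) * (2 - g x ^+ 2)) +
  (avg N (fun x => expR (- (4^-1 * u x)) * (2 - g x ^+ 2)) +
   (2 * avg N (fun x => g x ^+ 2) + -4)).
  rewrite -[- 4](avg_cst N) -avgZ -!avgD.
  by apply: eq_avg => x _; ring.
by lra.
Qed.

Lemma cosh_le (a : R) : expR a + expR (- a) <= 2 * expR (2 * a ^+ 2).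
Proof.
wlog a0 : a / 0 <= a.
  move=> H; case: (leP 0 a) => [/H//|a0].
  by have := H (- a); rewrite opprK sqrrN addrC; apply; rewrite oppr_ge0 ltW.
have [a2|a2] := leP a 2^-1.
  have := expR_le_quad a2; have h : - a <= 2^-1 by lra.
  have := expR_le_quad h; have := expR_ge1Dx (2 * a ^+ 2); rewrite sqrrN.
  by move=> *; lra.
have h1 : expR a <= expR (2 * a ^+ 2) by rewrite ler_expR; nra.
have h2 : expR (- a) <= expR a by rewrite ler_expR; lra.
by lra.
Qed.

(** As [nu 0 = 1], the first bit decides the sign of [a 0]; on the other coefficients it only
    changes signs, which their squares do not see. Averaging over it costs a hyperbolic cosine,
    bounded by [cosh_le]. *)
Lemma lacunary_subgaussian N nu (a : nat -> R) : dyadic_family nu ->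
  avg N (fun x => expR (\sum_(i < N) a i * wal (nu i) x)) <=
  expR (2 * \sum_(i < N) a i ^+ 2).
Proof.
elim: N nu a => [|N IH] nu a Hnu /=; first by rewrite !big_ord0 mulr0.
have nu0 := dyadic_family0 Hnu; pose nu' i := (nu i.+1)./2.
have Hnu' : dyadic_family nu' := dyadic_family_half Hnu.
have Hb b : avg N (child (fun x => expR (\sum_(i < N.+1) a i * wal (nu i) x)) b) <=
    expR ((-1) ^+ b * a 0%N) * expR (2 * \sum_(i < N) a i.+1 ^+ 2).
  pose a' i := (-1) ^+ (b && odd (nu i.+1)) * a i.+1.
  have -> : \sum_(i < N) a i.+1 ^+ 2 = \sum_(i < N) a' i ^+ 2.
    by apply: eq_bigr => i _; rewrite /a' exprMn sqrr_sign mul1r.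
  apply: le_trans (ler_wpM2l (expR_ge0 _) (IH nu' a' Hnu')).
  rewrite -avgZ; apply: le_avg => x _; rewrite /child big_ord_recl -expRD.
  rewrite /= nu0 /= andbT wal0 mulr1 mulrC ler_expR lerD2l.
  by apply: ler_sum => i _; rewrite /bump /= add1n /a' (mulrC _ (a _)) -mulrA.
rewrite ler_pdivrMr//; apply: le_trans (lerD (Hb false) (Hb true)) _.
rewrite -mulrDl /= expr0 expr1 mul1r mulN1r big_ord_recl /=.
by rewrite (mulrDr 2) expRD mulrAC ler_pM2r ?expR_gt0// mulrC; exact: cosh_le.
Qed.

End Exponential.

(** * Calderon-Zygmund decomposition adapted to a single frequency *)

Section Decomposition.
Context {R : realType}.
Implicit Types (f phi : seq bool -> R) (N n : nat) (th : R).

Lemma expR2_le : expR 2 <= 13 :> R.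
Proof.
(* [11 / 8] is the bound of [expR_le_quad] at [4^-1]; its eighth power is below 13. *)
have h : expR (4^-1 : R) <= 11 / 8.
  by apply: le_trans (expR_le_quad _) _; lra.
have -> : 2 = 8%:R * 4^-1 :> R by field.
rewrite expRM_natl; apply: (@le_trans _ _ ((11 / 8) ^+ 8)).
  by rewrite lerXn2r ?nnegrE ?expR_ge0//; lra.
by rewrite !exprS expr0; lra.
Qed.

(** By duality, the l^2 norm of the coefficients is the mean of [f * u], for a lacunary sum [u] with
    normalized coefficients. The exponential moments of [u] and [- u] are at most 13, so integrating
    [|u| <= - ln d + d * (expR u + expR (- u))] against [phi] gives at most [d * (26 - ln d)]. *)
Lemma lacunary_coef N f phi nu : dyadic_family nu ->
  (forall x, size x = N -> `|f x| <= phi x <= 1) -> 0 < avg N phi ->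
  \sum_(i < N) wcoef N f (nu i) ^+ 2 <=
  (avg N phi * (27 - ln (avg N phi))) ^+ 2.
Proof.
move=> Hnu fphi; set d := avg N phi => d0.
have d1 : d <= 1.
  by rewrite -[leRHS](avg_cst N); apply: le_avg => x /fphi/andP[].
have lnd : ln d <= 0 by rewrite ln_le0.
set S := \sum_(i < N) _.
have S0 : 0 <= S by apply: sumr_ge0 => i _; exact: sqr_ge0.
have [->|Sn0] := eqVneq S 0; first exact: sqr_ge0.
have A0 : 0 < Num.sqrt S by rewrite sqrtr_gt0 lt_neqAle eq_sym Sn0.
have SA : S = Num.sqrt S ^+ 2 by rewrite sqr_sqrtr.
set A := Num.sqrt S in A0 SA.
rewrite SA lerXn2r ?nnegrE ?(ltW A0)//; first by rewrite mulr_ge0 ?ltW//; lra.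
pose a i := wcoef N f (nu i) / A.
pose u x := \sum_(i < N) a i * wal (nu i) x.
have a1 : \sum_(i < N) a i ^+ 2 = 1.
  rewrite /a; under eq_bigr do rewrite exprMn.
  by rewrite -mulr_suml -/S SA exprVn mulfV// gt_eqF// exprn_gt0.
have -> : A = avg N (fun x => f x * u x).
  have -> : avg N (fun x => f x * u x) = \sum_(i < N) a i * wcoef N f (nu i).
    rewrite -[RHS]/(\sum_(i < N) _); under [RHS]eq_bigr do rewrite -avgZ.
    rewrite -avg_sum; apply: eq_avg => x _; rewrite mulr_sumr.
    by apply: eq_bigr => i _; rewrite mulrCA.
  rewrite /a; under eq_bigr do rewrite mulrAC -expr2.
  by rewrite -mulr_suml -/S SA expr2 mulfK// gt_eqF.
have up : avg N (fun x => expR (u x)) <= 13.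
  by apply: le_trans expR2_le; have := lacunary_subgaussian N a Hnu; rewrite a1 mulr1.
have um : avg N (fun x => expR (- u x)) <= 13.
  apply: le_trans expR2_le; have := lacunary_subgaussian N (fun i => - a i) Hnu.
  under [X in _ <= expR (2 * X) -> _]eq_bigr do rewrite sqrrN.
  rewrite a1 mulr1; apply: le_trans; apply: le_avg => x _.
  by rewrite /u -sumrN; under [in leRHS]eq_bigr do rewrite mulNr.
apply: (@le_trans _ _ (avg N (fun x =>
    - ln d * phi x + d * (expR (u x) + expR (- u x))))).
  apply: le_avg => x /fphi /andP[fx px].
  have px0 : 0 <= phi x by exact: le_trans fx.
  have hu : `|u x| <= expR (u x) + expR (- u x) by
    have := expR_ge1Dx (u x); have := expR_ge1Dx (- u x);
    have := expR_gt0 (u x); have := expR_gt0 (- u x);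
    rewrite ler_norml => *; apply/andP; split; lra.
  have key : `|u x| <= - ln d + d * (expR (u x) + expR (- u x)).
    have : expR `|u x| <= expR (u x) + expR (- u x).
      case: (leP 0 (u x)) => u0.
        by rewrite ger0_norm// lerDl expR_ge0.
      by rewrite ltr0_norm// lerDr expR_ge0.
    rewrite -(ler_pM2l d0) => h.
    have := expR_ge1Dx (`|u x| + ln d).
    by rewrite expRD lnK// (mulrC _ d) => ?; lra.
  apply: le_trans (ler_norm _) _; rewrite normrM.
  apply: le_trans (ler_wpM2r (normr_ge0 _) fx) _.
  apply: le_trans (ler_wpM2l px0 key) _.
  rewrite mulrDr (mulrC (phi x)) lerD2l ler_piMl//.
  by rewrite mulr_ge0 ?ltW// addr_gt0 ?expR_gt0.
rewrite avgD !avgZ avgD -[avg N (fun x => phi x)]/d.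
rewrite (_ : _ + _ = d * (avg N (fun x => expR (u x)) +
  avg N (fun x => expR (- u x)) - ln d)); last by ring.
by rewrite ler_pM2l// lerD2r; lra.
Qed.

Fixpoint stopped th N phi x : bool := (th < avg N phi) ||
  match N, x with
  | N'.+1, b :: x' => stopped th N' (child phi b) x'
  | _, _ => false
  end.

Fixpoint good th N phi f x : R :=
  if th < avg N phi then avg N f else
  match N, x with
  | N'.+1, b :: x' => good th N' (child phi b) (child f b) x'
  | _, _ => f x
  end.

(* Descending to a half interval turns [n] into [n./2]; the factor [0 < n] drops
   the component where the Walsh function has become constant. *)
Fixpoint bad th N phi f n x : R :=
  if th < avg N phi then (0 < n)%N%:R * (wcoef N f n * wal n x) else
  match N, x with
  | N'.+1, b :: x' => bad th N' (child phi b) (child f b) n./2 x'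
  | _, _ => 0
  end.

Lemma bad_stop th N phi f n x : th < avg N phi ->
  bad th N phi f n x = (0 < n)%N%:R * (wcoef N f n * wal n x).
Proof. by case: N => [|N] /= ->. Qed.

(** The weak (1,1) bound for the dyadic maximal function: Chebyshev's inequality on each of the
    disjoint stopping intervals. *)
Lemma avg_stopped th N phi : 0 < th ->
  (forall x, size x = N -> 0 <= phi x) ->
  avg N (fun x => (stopped th N phi x)%:R) <= avg N phi / th.
Proof.
move=> th0; elim: N phi => [|N IH] phi phi0.
  rewrite /= orbF ler_pdivlMr//; case: ltP => h; first by rewrite mul1r ltW.
  by rewrite mul0r phi0.
have [h|h] := ltP th (avg N.+1 phi).
  apply: (@le_trans _ _ 1); last by rewrite ler_pdivlMr// mul1r ltW.
  by rewrite -[leRHS](avg_cst N.+1); apply: le_avg => x _; rewrite lern1 leq_b1.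
rewrite !avgS ler_pdivrMr// mulrAC divfK// mulrDl.
have E b : avg N (child (fun x => (stopped th N.+1 phi x)%:R) b) <=
   avg N (child phi b) / th.
  apply: le_trans (IH _ _) => [|x sx]; last by rewrite phi0//= sx.
  by apply: le_avg => x _; rewrite /child /= ltNge h.
exact: lerD (E false) (E true).
Qed.

(** The descent only continues below intervals that do not stop, so every interval reached has
    density at most [2 * th]: the invariant of the inductions below. *)
Lemma avg_child_le th N phi b : (forall x, size x = N.+1 -> 0 <= phi x) ->
  avg N.+1 phi <= th -> avg N (child phi b) <= 2 * th.
Proof.
move=> phi0; rewrite avgS ler_pdivrMr// mulrC.
have h c : 0 <= avg N (child phi c).
  by apply: avg_ge0 => x sx; rewrite phi0//= sx.
by have := h (~~ b); case: b => /= *; lra.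
Qed.

Lemma good_bound th N phi f x : size x = N ->
  (forall x, size x = N -> `|f x| <= phi x) -> avg N phi <= 2 * th ->
  `|good th N phi f x| <= 2 * th.
Proof.
elim: N phi f x => [|N IH] phi f [|b x]//= => [_|[sx]] fphi phith.
  by apply: le_trans phith; case: ifP => _; rewrite fphi.
have phi0 y : size y = N.+1 -> 0 <= phi y by move/fphi; exact: le_trans.
case: ltP => h.
  apply: le_trans phith; rewrite -!avgS.
  by apply: le_trans (ler_norm_avg N.+1 f) _; exact: (@le_avg _ N.+1).
apply: IH => // [y sy|]; first by rewrite fphi//= sy.
exact: avg_child_le.
Qed.

Lemma avg_normr_good th N phi f :
  avg N (fun x => `|good th N phi f x|) <= avg N (fun x => `|f x|).
Proof.
elim: N phi f => [|N IH] phi f; first by rewrite /= if_same.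
have [h|h] := ltP th (avg N.+1 phi).
  rewrite [leLHS](_ : _ = `|avg N.+1 f|); first exact: ler_norm_avg.
  by rewrite -[RHS](avg_cst N.+1); apply: eq_avg => x _; rewrite /= h.
have E b : avg N (child (fun x => `|good th N.+1 phi f x|) b) <=
    avg N (child (fun x => `|f x|) b).
  apply: le_trans (IH (child phi b) (child f b)).
  by apply: le_avg => x _; rewrite /child /= ltNge h.
by rewrite !avgS ler_pM2r// lerD.
Qed.

Lemma avg_sqr_good th N phi f : 0 <= th ->
  (forall x, size x = N -> `|f x| <= phi x) -> avg N phi <= 2 * th ->
  avg N (fun x => good th N phi f x ^+ 2) <= 2 * th * avg N phi.
Proof.
move=> th0 fphi phith.
apply: (@le_trans _ _ (2 * th * avg N (fun x => `|good th N phi f x|))).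
  rewrite -avgZ; apply: le_avg => x sx.
  by rewrite -real_normK ?num_real// expr2 ler_wpM2r//; exact: good_bound.
rewrite ler_wpM2l ?mulr_ge0//; apply: le_trans (avg_normr_good _ _ _ _) _.
exact: le_avg.
Qed.

Lemma bad_bound th N phi f n x : 0 <= th -> size x = N ->
  (forall x, size x = N -> `|f x| <= phi x) -> avg N phi <= 2 * th ->
  `|bad th N phi f n x| <= 2 * th.
Proof.
move=> th0.
elim: N phi f n x => [|N IH] phi f n [|b x]//= => [_|[sx]] fphi phith.
  case: ifP => _; last by rewrite normr0 mulr_ge0.
  apply: le_trans phith; rewrite normrM mulr1 normr_nat.
  case: (0 < n)%N; last by rewrite mul0r (le_trans _ (fphi _ _)).
  by rewrite mul1r /wcoef /= mulr1 fphi.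
have phi0 y : size y = N.+1 -> 0 <= phi y by move/fphi; exact: le_trans.
case: ltP => h.
  apply: le_trans phith; rewrite -[(-1) ^+ _ * _]/(wal n (b :: x)).
  rewrite normrM normr_nat normrM normr_wal mulr1.
  have h1 : `|wcoef N.+1 f n| <= avg N.+1 phi.
    by apply: le_trans (ler_norm_wcoef _ _ _) _; exact: le_avg.
  apply: le_trans h1; rewrite ler_piMl//.
  by rewrite lern1 leq_b1.
apply: IH => // [y sy|]; first by rewrite fphi//= sy.
exact: avg_child_le.
Qed.

(** On a stopping interval the mean carries the coefficient of index 0 and the bad part that of
    index [n]. Should [n] have become 0 there, the factor [0 < n] in [bad] avoids counting it
    twice. *)
Lemma wcoef_good_bad th N phi f n : (n < 2 ^ N)%N ->
  wcoef N (fun x => good th N phi f x + bad th N phi f n x) n = wcoef N f n.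
Proof.
elim: N phi f n => [|N IH] phi f n nN.
  move: nN; rewrite expn0 ltnS leqn0 => /eqP ->.
  by rewrite /wcoef /=; case: ifP => _; rewrite ?mul0r addr0.
have [h|h] := ltP th (avg N.+1 phi).
  rewrite (_ : wcoef N.+1 _ n = wcoef N.+1 (fun x => avg N.+1 f * wal 0 x +
      (0 < n)%N%:R * (wcoef N.+1 f n * wal n x)) n); last first.
    by apply: eq_avg => x _; rewrite /= h wal0 mulr1.
  rewrite wcoefD !wcoefZ [wcoef _ (wal 0) _]avg_wal_mul ?expn_gt0//.
  rewrite [wcoef _ (wal n) _]avg_wal_mul// eqxx mulr1.
  have [->|n0] := posnP n; last first.
    by rewrite eq_sym gtn_eqF// mulr0 add0r mul1r.
  by rewrite mulr1 mul0r addr0 wcoef0.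
move: nN; rewrite expnS mul2n -ltn_half_double => nN.
have E b : wcoef N (child (fun x =>
    good th N.+1 phi f x + bad th N.+1 phi f n x) b) n./2 =
    wcoef N (child f b) n./2.
  rewrite -[RHS](IH (child phi b) _ _ nN).
  by apply: eq_avg => x _; rewrite /child /= ltNge h.
by rewrite !wcoefS !E.
Qed.

(** By [psumS], at a point that is not stopped the sum only sees, at each level, the coefficients of
    index [n./2] on the two halves, and [wcoef_good_bad] preserves exactly these. *)
Lemma psum_good_bad th N phi f n x : (n < 2 ^ N)%N -> size x = N ->
  ~~ stopped th N phi x ->
  psum N n f x = psum N n (good th N phi f) x + psum N n (bad th N phi f n) x.
Proof.
rewrite -psumD; elim: N phi f n x => [|N IH] phi f n [|b x]//= nN.
  by move: nN; rewrite expn0 ltnS leqn0 => /eqP ->; rewrite !psum0.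
move=> [sx]; rewrite negb_or => /andP[h st].
move: nN; rewrite expnS mul2n -ltn_half_double => nN.
have E c y : child (fun x => good th N.+1 phi f x + bad th N.+1 phi f n x) c y =
    good th N (child phi c) (child f c) y + bad th N (child phi c) (child f c) n./2 y.
  by rewrite /child /= (negbTE h).
rewrite !psumS (IH _ _ _ _ nN sx st).
congr (_ + _ * (_ / _ * _)).
  by apply: eq_psum => y _; rewrite E.
by congr (_ + _); [rewrite -(wcoef_good_bad th (child phi false) _ nN)
  | rewrite -(wcoef_good_bad th (child phi true) _ nN)];
  apply: eq_avg => y _; rewrite E.
Qed.

(** On a stopping interval the surviving orders again form a dyadic family, and the density lies
    between [th] and [2 * th], so [lacunary_coef] bounds the square sum there. Summing over the
    intervals produces the measure of the stopping set. *)
Lemma sum_sqr_bad th Lam N phi f nu : 0 < th -> dyadic_family nu ->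
  (forall x, size x = N -> `|f x| <= phi x <= 1) -> avg N phi <= 2 * th ->
  27 - ln th <= Lam ->
  \sum_(i < N) avg N (fun x => bad th N phi f (nu i) x ^+ 2) <=
  (2 * th * Lam) ^+ 2 * avg N (fun x => (stopped th N phi x)%:R).
Proof.
move=> th0 Hnu fphi phith HLam.
elim: N phi f nu Hnu fphi phith => [|N IH] phi f nu Hnu fphi phith.
  by rewrite big_ord0 mulr_ge0 ?sqr_ge0//=.
have phi0 y : size y = N.+1 -> 0 <= phi y.
  by move=> /fphi/andP[+ _]; exact: le_trans.
have [h|h] := ltP th (avg N.+1 phi).
  have -> : avg N.+1 (fun x => (stopped th N.+1 phi x)%:R) = 1 :> R.
    by rewrite -[RHS](avg_cst N.+1); apply: eq_avg => x _; rewrite /= h.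
  rewrite mulr1; apply: (@le_trans _ _ (\sum_(i < N.+1) wcoef N.+1 f (nu i) ^+ 2)).
    apply: ler_sum => i _; rewrite -[leRHS](avg_cst N.+1); apply: le_avg => x _.
    rewrite bad_stop//.
    rewrite !exprMn [wal _ _ ^+ 2]expr2 wal_sqr mulr1.
    have -> : (0 < nu i)%N.
      by have /andP[+ _] := Hnu i; apply: leq_trans; rewrite expn_gt0.
    by rewrite expr1n mul1r.
  have d0 : 0 < avg N.+1 phi by exact: lt_trans h.
  apply: le_trans (lacunary_coef Hnu fphi d0) _.
  have d1 : avg N.+1 phi <= 1.
    by rewrite -[leRHS](avg_cst N.+1); apply: le_avg => x /fphi/andP[].
  have ln1 : ln (avg N.+1 phi) <= 0 by rewrite ln_le0.
  have ln2 : ln th <= ln (avg N.+1 phi) by rewrite ler_ln ?posrE// ltW.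
  rewrite lerXn2r ?nnegrE//.
  - by rewrite mulr_ge0 ?(ltW d0)//; lra.
  - by rewrite !mulr_ge0 ?(ltW th0)//; lra.
  - by rewrite ler_pM ?(ltW d0)//; lra.
have nu0 := dyadic_family0 Hnu; pose nu' i := (nu i.+1)./2.
have Hnu' : dyadic_family nu' := dyadic_family_half Hnu.
(* Halving sends the order [nu 0 = 1] to 0, which has no bad part; the other orders become the
   family [nu']. *)
have bad0 M psi g y : bad th M psi g 0 y = 0.
  elim: M psi g y => [|M IHM] psi g y /=; first by rewrite mul0r if_same.
  by rewrite mul0r; case: ifP => //; case: y.
have Ib b : \sum_(i < N)
    avg N (fun x => bad th N (child phi b) (child f b) (nu' i) x ^+ 2) <=
    (2 * th * Lam) ^+ 2 * avg N (fun x => (stopped th N (child phi b) x)%:R).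
  apply: IH => // [x sx|]; first by rewrite fphi//= sx.
  exact: avg_child_le.
have Es b : avg N (child (fun x => (stopped th N.+1 phi x)%:R) b) =
    avg N (fun x => (stopped th N (child phi b) x)%:R) :> R.
  by apply: eq_avg => x _; rewrite /child /= ltNge h.
have Eb b m : avg N (child (fun x => bad th N.+1 phi f m x ^+ 2) b) =
    avg N (fun x => bad th N (child phi b) (child f b) m./2 x ^+ 2).
  by apply: eq_avg => x _; rewrite /child /= ltNge h.
rewrite big_ord_recl [avg _ _](_ : _ = 0) ?add0r; last first.
  rewrite -[RHS](avg_cst N.+1); apply: eq_avg => -[|b x] //= _.
  by rewrite ltNge h nu0 /= bad0 expr0n.
rewrite avgS !Es.
rewrite mulrA ler_pdivlMr// mulr_suml mulrDr.
apply: le_trans (lerD (Ib false) (Ib true)); rewrite -big_split.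
by apply: ler_sum => i _; rewrite avgS !Eb divfK.
Qed.

End Decomposition.

(** * The maximal bound for one order per dyadic block *)

Section Discrete.
Context {R : realType}.
Implicit Types (f phi : seq bool -> R) (N n : nat).

Lemma log_plus_ge (x : R) : 27 <= log_plus x.
Proof. by rewrite lerDl le_max lexx. Qed.

Lemma loglog_plus_ge1 (x : R) : 1 <= loglog_plus x.
Proof.
rewrite -ler_expR lnK; last by rewrite posrE (lt_le_trans _ (log_plus_ge x)).
apply: le_trans (log_plus_ge x); apply: (@le_trans _ _ (expR 2)).
  by rewrite ler_expR; lra.
by apply: le_trans expR2_le _; lra.
Qed.

Lemma dyadic_family_lt N (nu : nat -> nat) i : dyadic_family nu -> (i < N)%N ->
  (nu i < 2 ^ N)%N.
Proof.
move=> Hnu iN; have /andP[_ h] := Hnu i.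
by apply: leq_trans h _; rewrite leq_exp2l.
Qed.

(** The exceptional set has three parts: the stopping set ([t / 4]), the points where the good part
    is large ([t / 2]) and those where a bad part is large ([t / 4]). *)
Lemma discrete_lacunary_bound N nu f phi (t : R) : dyadic_family nu ->
  (forall x, size x = N -> `|f x| <= phi x <= 1) ->
  0 < avg N phi -> 0 < t <= 1 ->
  let s := 192 * (avg N phi / t) * loglog_plus (t / avg N phi) in
  avg N (fun x => [exists i : 'I_N, s < `|psum N (nu i) f x|]%R%:R) <= t.
Proof.
move=> Hnu fphi; set P := avg N phi => P0 /andP[t0 t1] /=.
set Lam := log_plus (t / P); set s := 192 * _ * _.
have Lam27 : 27 <= Lam by exact: log_plus_ge.
have lnL : 1 <= ln Lam by exact: loglog_plus_ge1.
pose th := 4 * (P / t).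
have Pt0 : 0 < P / t by exact: divr_gt0.
have th0 : 0 < th by rewrite mulr_gt0.
have sth : s = 48 * th * ln Lam by rewrite /s /th /loglog_plus -/Lam; ring.
(* Of these [3 * th], the sum of order [2 ^ i] of the good part takes [2 * th]; the last [th] is the
   level in Chebyshev's inequality. *)
have s3 : 3 * th <= s / 2 by rewrite sth; nra.
(* Since [t <= 1], the root satisfies the density bound with which the descent starts. *)
have Pth : P <= 2 * th.
  have : P <= P / t by rewrite ler_pdivlMr// ler_piMr// ltW.
  by rewrite /th => ?; lra.
have fphi1 x : size x = N -> `|f x| <= phi x by move=> /fphi/andP[].
have phi0 x : size x = N -> 0 <= phi x by move/fphi1; exact: le_trans.
have HLam : 27 - ln th <= Lam.
  rewrite /Lam /log_plus lerD2l -lnV ?posrE// le_max; apply/orP; right.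
  rewrite ler_ln ?posrE ?invr_gt0 ?divr_gt0// /th invfM invf_div.
  by rewrite ler_piMl ?divr_ge0 ?ltW//; lra.
pose q := avg N (fun x => (stopped th N phi x)%:R) : R.
have q0 : 0 <= q by apply: avg_ge0.
have qt : q <= t / 4.
  apply: le_trans (avg_stopped th0 phi0) _.
  by rewrite -/P ler_pdivrMr// /th (_ : t / 4 * _ = P) //; field; rewrite gt_eqF.
pose g := good th N phi f.
pose h (i : 'I_N) := bad th N phi f (nu i).
pose D (i : 'I_N) x := (psum N (nu i) g x - psum N (2 ^ i) g x) ^+ 2.
pose T (i : 'I_N) x : R := (s / 2 < `|psum N (nu i) (h i) x|)%R%:R.
have pointwise x : size x = N ->
    [exists i : 'I_N, s < `|psum N (nu i) f x|]%R%:R <=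
    (stopped th N phi x)%:R +
      ((th ^+ 2)^-1 * (\sum_(i < N) D i x) + \sum_(i < N) T i x).
  move=> sx.
  have D0 (j : 'I_N) : 0 <= D j x by exact: sqr_ge0.
  have T0 (j : 'I_N) : 0 <= T j x by rewrite ler0n.
  have SD0 : 0 <= (th ^+ 2)^-1 * \sum_(i < N) D i x.
    by rewrite mulr_ge0 ?invr_ge0 ?sqr_ge0// sumr_ge0.
  have ST0 : 0 <= \sum_(i < N) T i x by rewrite sumr_ge0.
  have [st|nst] := boolP (stopped th N phi x).
    by apply: (@le_trans _ _ 1); rewrite ?lern1 ?leq_b1// lerDl addr_ge0.
  rewrite add0r; case: existsP => [[i si]|_]; last exact: addr_ge0.
  have nuN := dyadic_family_lt Hnu (ltn_ord i).
  move: si; rewrite (psum_good_bad f nuN sx nst) -/g -/(h i) => si.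
  have [hi|hi] := ltP (s / 2) `|psum N (nu i) (h i) x|.
    rewrite -[leLHS]add0r lerD// (bigD1 i)//= {1}/T hi lerDl.
    by apply: sumr_ge0.
  rewrite -[leLHS]addr0 lerD//.
  rewrite mulrC ler_pdivlMr ?exprn_gt0// mul1r (bigD1 i)//=.
  apply: (@le_trans _ _ (D i x)); last by rewrite lerDl sumr_ge0.
  have gs : s / 2 <= `|psum N (nu i) g x|.
    have := ler_normD (psum N (nu i) g x) (psum N (nu i) (h i) x).
    by move=> ?; lra.
  have gb : `|psum N (2 ^ i) g x| <= 2 * th.
    apply: psum_pow2_bound => //; first exact: ltnW.
    by move=> y sy; apply: good_bound.
  have : th <= `|psum N (nu i) g x - psum N (2 ^ i) g x|.
    have := lerB_dist (psum N (nu i) g x) (psum N (2 ^ i) g x).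
    by move=> ?; lra.
  rewrite /D -[X in _ -> _ <= X]real_normK ?num_real// => ?.
  by rewrite lerXn2r ?nnegrE// ltW.
apply: le_trans (le_avg pointwise) _.
rewrite avgD avgD avgZ !avg_sum -/q.
have H1 : (th ^+ 2)^-1 * \sum_(i < N) avg N (D i) <= t / 2.
  have : \sum_(i < N) avg N (D i) <= 2 * th * P.
    apply: le_trans (lacunary_square_sum N g Hnu) _.
    by apply: avg_sqr_good => //; exact: ltW.
  move=> /(ler_wpM2l (_ : 0 <= (th ^+ 2)^-1)) => /(_ _)/le_trans; apply.
    by rewrite invr_ge0 sqr_ge0.
  by rewrite (_ : _ * (_ * P) = t / 2)// /th; field; rewrite !gt_eqF.
have H2 : \sum_(i < N) avg N (T i) <= t / 4.
  have L0 : 0 < Lam by lra.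
  (* The constant 192 makes the exponent [3 * ln Lam]: one power of [Lam] more than the [Lam ^+ 2]
     lost in [sum_sqr_bad], and with [Lam >= 27] it absorbs the constants. *)
  have expE : expR (4^-1 * ((s / 2) / (2 * th))) = Lam ^+ 3.
    rewrite (_ : 4^-1 * _ = 3%:R * ln Lam); last first.
      by rewrite sth; field; rewrite gt_eqF.
    by rewrite expRM_natl lnK.
  have L3 : 2 * Lam ^+ 2 <= Lam ^+ 3 - 2.
    have : 27 * Lam ^+ 2 <= Lam ^+ 3 by rewrite (exprS _ 2) ler_wpM2r ?sqr_ge0.
    have : 1 <= Lam ^+ 2 by rewrite exprn_ege1//; lra.
    by move=> *; lra.
  have L2 : 0 < 2 * Lam ^+ 2 by rewrite mulr_gt0 ?exprn_gt0.
  rewrite -(ler_pM2l L2).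
  apply: (@le_trans _ _ ((Lam ^+ 3 - 2) * \sum_(i < N) avg N (T i))).
    rewrite ler_wpM2r// sumr_ge0// => i _.
    by apply: avg_ge0 => x _; rewrite ler0n.
  apply: (@le_trans _ _ (2 * (\sum_(i < N) avg N (fun x => h i x ^+ 2)) /
      (2 * th) ^+ 2)).
    rewrite mulr_sumr mulr_sumr mulr_suml; apply: ler_sum => i _.
    rewrite -expE; apply: psum_tail; first exact: dyadic_family_lt.
      by rewrite mulr_gt0.
    by move=> x sx; apply: bad_bound => //; exact: ltW.
  have := sum_sqr_bad th0 Hnu fphi Pth HLam; rewrite -/q => hq.
  rewrite ler_pdivrMr ?exprn_gt0 ?mulr_gt0 ?invr_gt0//.
  apply: le_trans (ler_wpM2l _ hq) _ => //.
  have := ler_wpM2l (_ : 0 <= (2 * th * Lam) ^+ 2) qt.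
  move=> /(_ (sqr_ge0 _)) hq2.
  rewrite (_ : 2 * Lam ^+ 2 * _ * _ = 2 * ((2 * th * Lam) ^+ 2 * (t / 4))).
    by rewrite ler_pM2l.
  by ring.
by apply: le_trans (lerD qt (lerD H1 H2)) _; lra.
Qed.

End Discrete.

(** * Dyadic intervals of the unit interval and the Walsh functions on them *)

Section DyadicIntervals.
Context {R : realType}.
Implicit Types (N n k : nat) (x : seq bool) (y : R).

Fixpoint lft x : R := if x is b :: x' then (b%:R + lft x') / 2 else 0.

Lemma lft_ge0 x : 0 <= lft x.
Proof. by elim: x => //= b x IH; rewrite divr_ge0// addr_ge0. Qed.

Lemma lft_le1 N x : size x = N -> lft x + (2 ^+ N)^-1 <= 1.
Proof.
elim: N x => [|N IH] [|b x]//= => [_|[/IH h]]; first by rewrite add0r expr0 invr1.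
have hb : b%:R <= 1 :> R by case: b.
by rewrite exprS invfM (mulrC 2^-1) -mulrDl ler_pdivrMr//; lra.
Qed.

(** Stated for functions of an interval, so that one bisection argument serves integrals, measures
    and outer measures. The factor [2 ^+ N] turns the average into a sum over cells. *)
Lemma subadditive_le_avg N (m : R -> R -> R) :
  (forall a b c, a <= b <= c -> m a c <= m a b + m b c) ->
  m 0 1 <= avg N (fun x => 2 ^+ N * m (lft x) (lft x + (2 ^+ N)^-1)).
Proof.
move=> mD.
suff H a h : 0 <= h -> m a (a + h) <= avg N (fun x =>
    2 ^+ N * m (a + h * lft x) (a + h * lft x + h / 2 ^+ N)).
  have := H 0 1 ler01; rewrite add0r => h; apply: le_trans h _.
  by apply: le_avg => x _; rewrite add0r !mul1r.
elim: N a h => [|N IH] a h h0.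
  by rewrite /= expr0 mul1r mulr0 divr1 addr0.
have h20 : 0 <= h / 2 by rewrite divr_ge0.
apply: (@le_trans _ _ (m a (a + h / 2) + m (a + h / 2) (a + h / 2 + h / 2))).
  rewrite [in leLHS](splitr h) addrA; apply: mD.
  by rewrite lerDl h20 lerDl h20.
apply: le_trans (lerD (IH _ _ h20) (IH _ _ h20)) _.
rewrite -avgD avgS -avgD -avgZr; apply: le_avg => x _; rewrite /child /=.
rewrite (_ : a + h / 2 + h / 2 * lft x = a + h * ((1 + lft x) / 2)); last by field.
rewrite (_ : a + h / 2 * lft x = a + h * ((0 + lft x) / 2)); last by field.
rewrite (_ : h / 2 / 2 ^+ N = h / 2 ^+ N.+1); last by rewrite exprS invfM mulrA.
rewrite -mulrDr -mulrDr mulrAC exprS [2 * _ / 2]mulrAC divff// mul1r.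
exact: lexx.
Qed.

Lemma additive_eq_avg N (m : R -> R -> R) :
  (forall a b c, a <= b <= c -> m a c = m a b + m b c) ->
  m 0 1 = avg N (fun x => 2 ^+ N * m (lft x) (lft x + (2 ^+ N)^-1)).
Proof.
move=> mD; apply/eqP; rewrite eq_le subadditive_le_avg/=; last first.
  by move=> a b c abc; rewrite (mD _ _ _ abc).
rewrite -lerN2 -avgN.
under eq_avg do rewrite -mulrN.
apply: (@subadditive_le_avg N (fun a b => - m a b)) => a b c abc.
by rewrite (mD _ _ _ abc) opprD.
Qed.

Lemma sg_sin (b : bool) y : b%:R / 2 < y < (b%:R + 1) / 2 ->
  Num.sg (sin (2 * pi * y)) = (-1) ^+ b :> R.
Proof.
have pi0 : 0 < pi :> R := pi_gt0 R.
move=> /andP[]; case: b => h1 h2.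
  have y1 : 1 / 2 < y := h1; have y2 : y < (1 + 1) / 2 := h2.
  have p1 : 0 < pi * (2 * y - 1) by rewrite mulr_gt0//; lra.
  have p2 : 0 < pi * (2 - 2 * y) by rewrite mulr_gt0//; lra.
  have s0 : 0 < sin (2 * pi * y - pi) by apply: sin_gt0_pi; apply/andP; split; lra.
  by rewrite -[2 * pi * y](subrK pi) sinDpi sgrN gtr0_sg// expr1.
have y1 : 0 / 2 < y := h1; have y2 : y < (0 + 1) / 2 := h2.
have p1 : 0 < pi * y by rewrite mulr_gt0//; lra.
have p2 : 0 < pi * (1 - 2 * y) by rewrite mulr_gt0//; lra.
have s0 : 0 < sin (2 * pi * y) by apply: sin_gt0_pi; apply/andP; split; lra.
by rewrite gtr0_sg.
Qed.

Lemma sin_dyadic_shift i (b : bool) y :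
  sin (2 ^+ i.+2 * pi * y) = sin (2 ^+ i.+1 * pi * (2 * y - b%:R)) :> R.
Proof.
rewrite -[RHS](periodicn (@sinD2pi R) (b * 2 ^ i)); congr sin.
by rewrite -[_ *+ (_ * _)]mulr_natr natrM natrX -[pi *+ 2]mulr_natr !exprS; ring.
Qed.

(** The number of factors is [N] whatever [n] is, which pads the expansion of [n] with zero digits
    and permits induction on [N]. *)
Definition walsh_prod N n y : R :=
  \prod_(k < N) Num.sg (sin (2 ^+ k.+1 * pi * y)) ^+ bindigit n k.

Lemma walsh_prodS N n y (b : bool) : b%:R / 2 < y < (b%:R + 1) / 2 ->
  walsh_prod N.+1 n y = (-1) ^+ (b && odd n) * walsh_prod N n./2 (2 * y - b%:R).
Proof.
move=> yb; rewrite /walsh_prod big_ord_recl; congr (_ * _).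
  rewrite expr1 (sg_sin yb) /bindigit expn0 divn1.
  by case: (odd n); rewrite ?andbT ?andbF// expr1.
apply: eq_bigr => i _; rewrite -sin_dyadic_shift; congr (_ ^+ _).
by rewrite /bindigit /= /bump /= add1n expnS divnMA divn2.
Qed.

Lemma walsh_prodE N n y : (0 < N)%N -> (n < 2 ^ N)%N ->
  walsh n y = walsh_prod N n y.
Proof.
move=> N0 nN; rewrite /walsh /walsh_prod.
have tN : ((trunc_log 2 n).+1 <= N)%N.
  have [->|n0] := posnP n; first by rewrite trunc_log0.
  by rewrite -(ltn_exp2l _ _ (isT : 1 < 2)%N) (leq_ltn_trans _ nN)// trunc_logP.
rewrite (big_ord_widen _
  (fun k => Num.sg (sin (2 ^+ k.+1 * pi * y)) ^+ bindigit n k) tN).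
rewrite big_mkcond; apply: eq_bigr => i _; case: ltnP => // ti.
rewrite /bindigit divn_small ?expr0//.
by rewrite (leq_trans (trunc_log_ltn n (isT : 1 < 2)%N))// leq_exp2l.
Qed.

(** The endpoints are excluded because a sine may vanish there, and with it the product. *)
Lemma walsh_prod_dyadic N n x y : size x = N ->
  lft x < y < lft x + (2 ^+ N)^-1 -> walsh_prod N n y = wal n x.
Proof.
elim: N n x y => [|N IH] n [|b x] y //=; first by rewrite /walsh_prod big_ord0.
move=> [sx] /andP[y1 y2].
have l0 := lft_ge0 x; have l1 := lft_le1 sx.
move: y2; rewrite exprS invfM (mulrC 2^-1) -mulrDl ltr_pdivlMr// => y2.
move: y1; rewrite ltr_pdivrMr// => y1.
rewrite (@walsh_prodS _ _ _ b); last first.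
  by rewrite ltr_pdivrMr// ltr_pdivlMr//; apply/andP; split; lra.
congr (_ * _); apply: IH => //; apply/andP; split; lra.
Qed.

Lemma walsh_dyadic N n x y : (0 < N)%N -> (n < 2 ^ N)%N -> size x = N ->
  lft x < y < lft x + (2 ^+ N)^-1 -> walsh n y = wal n x.
Proof.
by move=> N0 nN sx yx; rewrite (walsh_prodE _ N0 nN) (walsh_prod_dyadic _ sx).
Qed.

Lemma normr_walsh_le1 n y : `|walsh n y| <= 1.
Proof.
rewrite /walsh normr_prod; apply: prodr_ile1 => i _; rewrite normr_ge0/=.
by rewrite normrX exprn_ile1// normr_sg lern1 leq_b1.
Qed.

End DyadicIntervals.

(** * Lebesgue measure on the unit interval *)

Section LebesgueType.
Context {R : realType}.
Notation mu := (lebmeas R).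
Notation I := (unit_itv R).
Implicit Types (A B : set (lebesgueType R)).

Lemma measurable_lebesgueType (A : set (measurableTypeR R)) :
  measurable A -> measurable (A : set (lebesgueType R)).
Proof. by move=> mA; apply: sub_caratheodory. Qed.

Lemma measurable_unit_itv : measurable I.
Proof. by apply: measurable_lebesgueType; exact: measurable_itv. Qed.

Lemma measurable_co_itv (a b : R) : measurable (`[a, b[ : set (lebesgueType R)).
Proof. by apply: measurable_lebesgueType; exact: measurable_itv. Qed.

Lemma measurable_lebesgue_set1 (a : R) : measurable ([set a] : set (lebesgueType R)).
Proof. by apply: measurable_lebesgueType; exact: measurable_set1. Qed.

Lemma lebmeas_set1 (a : R) : mu [set a] = 0%E.
Proof. exact: lebesgue_measure_set1. Qed.

Lemma lebmeas_co_itv (a b : R) : a <= b -> mu `[a, b[ = (b - a)%:E.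
Proof.
move=> ab; transitivity (lebesgue_measure (`[a, b[ : set R)) => //.
rewrite lebesgue_measure_itv/= lte_fin; case: ltP => // ba.
by rewrite (@le_anti _ _ a b) ?ab// subrr.
Qed.

Lemma lebmeas_unit_itv : mu I = 1%E.
Proof.
transitivity (lebesgue_measure (`[0, 1] : set R)) => //.
by rewrite lebesgue_measure_itv/= lte_fin ltr01 -EFinB subr0.
Qed.

(* The Caratheodory measure is the restriction of an outer measure, so that
   monotonicity and subadditivity need no measurability. *)
Lemma le_lebmeas A B : A `<=` B -> (mu A <= mu B)%E.
Proof. exact: (@le_outer_measure R _ ((wlength (@idfun R))^*)%mu). Qed.

Lemma lebmeasU2 A B : (mu (A `|` B) <= mu A + mu B)%E.
Proof. exact: (outer_measureU2 ((wlength (@idfun R))^*)%mu). Qed.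

Lemma lebmeas_fin_num A : A `<=` I -> mu A \is a fin_num.
Proof.
move=> AI; rewrite ge0_fin_numE; last exact: outer_measure_ge0.
by apply: le_lt_trans (le_lebmeas AI) _; rewrite lebmeas_unit_itv ltry.
Qed.

(** The half-open cells miss the point 1, which is split off as a null set. *)
Lemma unit_itv_split : I = (I `&` `[0, 1[) `|` [set 1].
Proof.
apply/seteqP; split => y /=; rewrite /unit_itv /= !in_itv/=.
  move=> /andP[y0 y1]; have [yl|yg] := ltP y 1; first by left; rewrite y0 y1.
  by right; apply/le_anti; rewrite y1 yg.
by move=> [[]//|->]; rewrite ler01 lexx.
Qed.

Lemma itv_co_split (a b c : R) : a <= b <= c ->
  `[a, c[%classic = `[a, b[ `|` `[b, c[ :> set R.
Proof.
move=> /andP[ab bc]; apply/seteqP; split => y /=; rewrite !in_itv/=.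
  by move=> /andP[ay yc]; case: (ltP y b) => yb; [left; rewrite ay|right].
move=> [/andP[-> yb]|/andP[yb ->]]; first exact: lt_le_trans bc.
by rewrite (le_trans ab).
Qed.

Lemma itv_co_disj (a b c : R) (A : set R) :
  [disjoint A `&` `[a, b[ & A `&` `[b, c[].
Proof.
apply/eqP; rewrite -subset0 => y /= [[_ +] [_ +]]; rewrite !in_itv/=.
by move=> /andP[_ /lt_geF h] /andP[+ _]; rewrite h.
Qed.

Lemma measurable_walsh (D : set (lebesgueType R)) n :
  measurable_fun D (walsh n : lebesgueType R -> R).
Proof.
apply: (@measurable_funS _ _ _ _ setT) => //.
have mw : measurable_fun setT (walsh n : measurableTypeR R -> R).
  apply: measurable_prod => i _; apply: measurable_funX.
  have msin : measurable_fun setT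
      (fun y : measurableTypeR R => sin (2 ^+ i.+1 * pi * y)).
    apply: continuous_measurable_fun => y.
    apply: continuous_comp; last exact: continuous_sin.
    by apply: mulrl_continuous.
  have msg : measurable_fun setT (@Num.sg R : measurableTypeR R -> R).
    rewrite (_ : Num.sg = fun y => \1_(`]0, +oo[) y - \1_(`]-oo, 0[) y).
      by apply: measurable_funB; apply: measurable_indic; exact: measurable_itv.
    apply/funext => y; rewrite !indicE !mem_setE !in_itv/= andbT.
    by case: (sgrP y) => // _; rewrite ?subrr ?subr0 ?sub0r.
  exact: measurableT_comp msg msin.
move=> _ Y mY; apply: measurable_lebesgueType.
by apply: mw => //; exact: measurableT.
Qed.

End LebesgueType.

(** * From functions on the unit interval to averages over dyadic cells *)

Section DyadicAverages.
Context {R : realType}.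
Notation mu := (lebmeas R).
Notation I := (unit_itv R).
Implicit Types (f g : lebesgueType R -> R) (F B : set (lebesgueType R)).

Definition cell N (x : seq bool) : set (lebesgueType R) :=
  `[lft x, lft x + (2 ^+ N)^-1[.

Definition dyadic_avg N f (x : seq bool) : R :=
  2 ^+ N * \int[mu]_(y in I `&` cell N x) f y.

Definition dyadic_density N F (x : seq bool) : R :=
  2 ^+ N * fine (mu (F `&` cell N x)).

Lemma cell_interior N x (y : R) : cell N x y -> y != lft x ->
  lft x < y < lft x + (2 ^+ N)^-1.
Proof.
by rewrite /cell /= in_itv/= => /andP[ly ->] yx; rewrite lt_neqAle eq_sym yx ly.
Qed.

Lemma lebmeas_cell N x : mu (cell N x) = ((2 ^+ N)^-1)%:E.
Proof.
rewrite lebmeas_co_itv; first by rewrite addrAC subrr add0r.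
by rewrite lerDl invr_ge0 exprn_ge0.
Qed.

Lemma measurable_unit_itvI (a b : R) : measurable (I `&` `[a, b[).
Proof. exact: measurableI measurable_unit_itv (measurable_co_itv _ _). Qed.

Lemma integrable_unit_itvI g (a b : R) : mu.-integrable I (EFin \o g) ->
  mu.-integrable (I `&` `[a, b[) (EFin \o g).
Proof.
move=> ig; apply: integrableS ig => //; first exact: measurable_unit_itv.
exact: measurable_unit_itvI.
Qed.

Lemma Rintegral_unit_itv N g : mu.-integrable I (EFin \o g) ->
  \int[mu]_(y in I) g y = avg N (dyadic_avg N g).
Proof.
move=> ig.
pose m (a b : R) := \int[mu]_(y in I `&` `[a, b[) g y.
transitivity (m 0 1).
  rewrite unit_itv_split Rintegral_setU/=.
  - rewrite [X in _ + X](_ : _ = 0) ?addr0//.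
    rewrite /Rintegral null_set_integral//; last exact: lebmeas_set1.
      exact: measurable_lebesgue_set1.
    apply: measurable_funS (measurable_int _ ig); first exact: measurable_unit_itv.
    by rewrite unit_itv_split; exact: subsetUr.
  - exact: measurable_unit_itvI.
  - exact: measurable_lebesgue_set1.
  - by rewrite -unit_itv_split.
  - apply/eqP; rewrite -subset0 => y /= [[_ y1] ye]; move: y1.
    by rewrite ye in_itv/= ltxx andbF.
rewrite (@additive_eq_avg _ N m)// => a b c abc.
rewrite /m (itv_co_split abc) setIUr Rintegral_setU//.
- exact: measurable_unit_itvI.
- exact: measurable_unit_itvI.
- by rewrite -setIUr -itv_co_split//; exact: integrable_unit_itvI.
- exact: itv_co_disj.
Qed.

Lemma integrable_majorized f F n : measurable_fun I f -> majorized f F ->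
  mu.-integrable I (EFin \o (fun y => f y * walsh n y)).
Proof.
move=> mf hf; apply: measurable_bounded_integrable.
- exact: measurable_unit_itv.
- have : (mu I < +oo)%E by rewrite lebmeas_unit_itv ltry.
  exact.
- by apply: measurable_funM => //; exact: measurable_walsh.
- exists 1; split => // M M1 y /= Iy.
  apply: le_trans (ltW M1); rewrite normrM mulr_ile1//; last exact: normr_walsh_le1.
  by apply: le_trans (hf _ Iy) _; rewrite indicE lern1 leq_b1.
Qed.

Lemma integrable_majorized0 f F : measurable_fun I f -> majorized f F ->
  mu.-integrable I (EFin \o f).
Proof.
move=> mf hf; have := integrable_majorized 0 mf hf; congr (integrable _ _ _).
apply/funext => y /=; rewrite /walsh trunc_log0 big_ord_recl big_ord0.
by rewrite /bindigit div0n expr0 !mulr1.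
Qed.

Lemma Rintegral_cell_walsh f F N n x : measurable_fun I f -> majorized f F ->
  (0 < N)%N -> (n < 2 ^ N)%N -> size x = N ->
  \int[mu]_(y in I `&` cell N x) (f y * walsh n y) =
  \int[mu]_(y in I `&` cell N x) f y * wal n x.
Proof.
move=> mf hf N0 nN sx.
have if0 := integrable_majorized0 mf hf.
have ifw := integrable_majorized n mf hf.
have mC : measurable (I `&` cell N x) by exact: measurable_unit_itvI.
rewrite -RintegralZr//; last exact: integrable_unit_itvI.
have m1 : measurable ([set lft x] : set (lebesgueType R)).
  exact: measurable_lebesgue_set1.
have i2 : mu.-integrable (I `&` cell N x) (EFin \o (fun y => f y * wal n x)).
  apply: eq_integrable (integrableZr mC (wal n x) (integrable_unit_itvI _ _ if0)).
    exact: mC.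
  by move=> y _ /=; rewrite EFinM.
have iC := integrable_unit_itvI (lft x) (lft x + (2 ^+ N)^-1) ifw.
have m0 := lebmeas_set1 (lft x : R).
(* Removing the left endpoint, a null set, leaves points of the open cell, where [walsh n] is
   constant. *)
rewrite /Rintegral (negligible_integral m1 mC iC m0).
rewrite [in RHS](negligible_integral m1 mC i2 m0).
congr fine; apply: eq_integral => y; rewrite inE => -[[_ cy] yx].
rewrite /= (walsh_dyadic N0 nN sx (cell_interior cy _))//.
by apply/eqP.
Qed.

Lemma walsh_coef_dyadic f F N n : measurable_fun I f -> majorized f F ->
  (0 < N)%N -> (n < 2 ^ N)%N ->
  walsh_coef f n = wcoef N (dyadic_avg N f) n.
Proof.
move=> mf hf N0 nN; rewrite /walsh_coef.
rewrite (Rintegral_unit_itv N (integrable_majorized n mf hf)).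
apply: eq_avg => x sx; rewrite /dyadic_avg.
by rewrite (Rintegral_cell_walsh mf hf N0 nN sx) mulrA.
Qed.

Lemma walsh_psum_dyadic f F N n x y : measurable_fun I f -> majorized f F ->
  (0 < N)%N -> (n.+1 < 2 ^ N)%N -> size x = N -> cell N x y -> y != lft x ->
  walsh_psum n f y = psum N n.+1 (dyadic_avg N f) x.
Proof.
move=> mf hf N0 nN sx cy yx; apply: eq_bigr => k _.
have kN : (k < 2 ^ N)%N by rewrite (leq_trans (ltn_ord k))// ltnW.
by rewrite (walsh_coef_dyadic mf hf N0 kN)
  (walsh_dyadic N0 kN sx (cell_interior cy yx)).
Qed.

Lemma dyadic_avg_le f F N x : measurable F -> F `<=` I ->
  measurable_fun I f -> majorized f F -> size x = N ->
  `|dyadic_avg N f x| <= dyadic_density N F x <= 1.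
Proof.
move=> mF FI mf hf sx; apply/andP; split; last first.
  rewrite /dyadic_density mulrC -ler_pdivlMr ?exprn_gt0// mul1r.
  rewrite -lee_fin fineK; last first.
    by apply: lebmeas_fin_num; apply: subset_trans FI; exact: subIsetl.
  by rewrite -(lebmeas_cell N x); apply: le_lebmeas; exact: subIsetr.
have if0 := integrable_majorized0 mf hf.
have mC : measurable (I `&` cell N x) by exact: measurable_unit_itvI.
have iC : mu.-integrable (I `&` cell N x) (EFin \o f).
  exact: integrable_unit_itvI.
rewrite /dyadic_avg normrM ger0_norm ?exprn_ge0// ler_pM2l ?exprn_gt0//.
apply: le_trans (le_normr_Rintegral mC iC) _.
have -> : fine (mu (F `&` cell N x)) =
    \int[mu]_(y in I `&` cell N x) (\1_F y : R).
  rewrite /Rintegral integral_indic//; congr (fine (mu _)).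
  by rewrite setIA (setIidl FI).
apply: le_Rintegral => //.
- exact: integrable_norm.
- apply: (@measurable_bounded_integrable _ _ _ mu).
  + exact: mC.
  + rewrite -ge0_fin_numE; last exact: outer_measure_ge0.
    by apply: lebmeas_fin_num; exact: subIsetl.
  + exact: measurable_indic.
  + exists 1; split => // M M1 y /= _; apply: le_trans (ltW M1).
    by rewrite normr_nat lern1 leq_b1.
- by move=> y [Iy _]; exact: hf.
Qed.

Lemma avg_dyadic_density N F : measurable F -> F `<=` I ->
  avg N (dyadic_density N F) = fine (mu F).
Proof.
move=> mF FI; pose m (a b : R) := fine (mu (F `&` `[a, b[)).
have fin A : mu (F `&` A) \is a fin_num.
  by apply: lebmeas_fin_num; apply: subset_trans FI; exact: subIsetl.
transitivity (m 0 1).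
  rewrite [RHS](@additive_eq_avg _ N m)// => a b c abc.
  rewrite /m (itv_co_split abc) setIUr measureU ?fineD ?fin//.
  - by apply: measurableI => //; exact: measurable_co_itv.
  - by apply: measurableI => //; exact: measurable_co_itv.
  - by apply/eqP; exact: itv_co_disj.
rewrite /m -[in RHS](setIidl FI) unit_itv_split setIUr.
congr fine; apply/eqP; rewrite eq_le; apply/andP; split.
  apply: le_lebmeas => y [Fy y01]; left; split => //; split => //.
  exact: FI.
apply: le_trans (lebmeasU2 _ _) _; rewrite -[leRHS]adde0 leeD//.
  by apply: le_lebmeas => y [? []].
by rewrite -(lebmeas_set1 1); apply: le_lebmeas; exact: subIsetr.
Qed.

(** A cell on which [P] fails meets [B] at most in its left endpoint. Only monotonicity and
    subadditivity of the outer measure enter, so [B] can be a level set of the maximal function as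
    it stands. *)
Lemma lebmeas_le_avg N B (P : pred (seq bool)) : B `<=` I ->
  (forall x y, size x = N -> cell N x y -> y != lft x -> B y -> P x) ->
  (mu B <= (avg N (fun x => (P x)%:R))%:E)%E.
Proof.
move=> BI HP; pose m (a b : R) := fine (mu (B `&` `[a, b[)).
have fin A : mu (B `&` A) \is a fin_num.
  by apply: lebmeas_fin_num; apply: subset_trans BI; exact: subIsetl.
apply: (@le_trans _ _ (m 0 1)%:E).
  rewrite fineK// -[leRHS]adde0 -(lebmeas_set1 1).
  apply: le_trans (lebmeasU2 _ _); apply: le_lebmeas => y By.
  have := BI _ By; rewrite unit_itv_split => -[[_ ?]|->]; by [left|right].
rewrite lee_fin; apply: le_trans (@subadditive_le_avg _ N m _) _.
  move=> a b c abc; rewrite /m (itv_co_split abc) setIUr -fineD//.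
  by rewrite fine_le ?lebmeasU2// ?fin_numD ?fin// -setIUr.
apply: le_avg => x sx; have [Px|nPx] := boolP (P x).
  rewrite mulrC -ler_pdivlMr ?exprn_gt0// mul1r -lee_fin fineK//.
  by rewrite -(lebmeas_cell N x); apply: le_lebmeas; exact: subIsetr.
rewrite /m [X in fine X](_ : _ = 0%E) ?mulr0//.
apply/eqP; rewrite eq_le; apply/andP; split; last exact: outer_measure_ge0.
rewrite -(lebmeas_set1 (lft x)); apply: le_lebmeas => y [By cy].
by apply/eqP/negP => /negP yx; move/negP: nPx; apply; exact: HP cy yx By.
Qed.

End DyadicAverages.

(** * Splitting a lacunary sequence into families with one order per dyadic block *)

Section Lacunary.
Context {R : realType}.
Context (alpha : R) (J : nat) (n : 'I_J -> nat) (M : nat)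
  (alpha1 : 1 < alpha) (hn : lacunary alpha n)
  (M0 : (0 < M)%N) (alphaM : 4 <= alpha ^+ M).

Lemma lacunary_growth (i j : 'I_J) : (i <= j)%N ->
  alpha ^+ (j - i) * (n i)%:R <= (n j)%:R.
Proof.
have [n0 _ nr] := hn.
move=> /subnKC; move: (j - i)%N => d.
elim: d j => [|d IH] j ij.
  by rewrite expr0 mul1r (_ : j = i)//; apply: val_inj; rewrite /= -ij addn0.
have dJ : (i + d < J)%N by rewrite (leq_trans _ (ltn_ord j))// -ij addnS.
have := nr (Ordinal dJ) j; rewrite /= -ij addnS => /(_ erefl).
rewrite ler_pdivlMr ?ltr0n ?n0// => h; apply: le_trans h.
by rewrite exprS -mulrA ler_pM2l ?(lt_trans ltr01)//; exact: IH.
Qed.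

Lemma lacunary_gap (i j : 'I_J) : (i + M <= j)%N -> (4 * n i <= n j)%N.
Proof.
move=> ij; have ij' : (i <= j)%N by rewrite (leq_trans _ ij)// leq_addr.
rewrite -(ler_nat R) natrM; apply: le_trans (lacunary_growth ij').
rewrite ler_wpM2r//; apply: le_trans alphaM _.
by rewrite ler_weXn2l ?(ltW alpha1)// leq_subRL.
Qed.

Definition level (j : 'I_J) := trunc_log 2 (n j).+1.

(** Distinct indices of a class differ by at least [M], so their orders have ratio at least 4. A
    common block would force [n j + 1 < 2 * (n i + 1)], which a ratio of 2 would not exclude because
    of the shift by one. *)
Lemma level_inj_mod (i j : 'I_J) : i = j %[mod M] -> level i = level j -> i = j.
Proof.
wlog: i j / (i < j)%N => [H ij lij|ij eij lij].
  have [h|h|h] := ltngtP i j; [exact: H|by apply/esym/H|exact: val_inj].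
have ijM : (i + M <= j)%N.
  have : (M %| j - i)%N by rewrite -eqn_mod_dvd ?(ltnW ij)// eij.
  by move=> /dvdn_leq; rewrite subn_gt0 ij => /(_ isT); rewrite leq_subRL// ltnW.
have g := lacunary_gap ijM; have [n0 _ _] := hn; have ni := n0 i.
have l1 := trunc_logP (isT : 1 < 2)%N (isT : 0 < (n i).+1)%N.
have l2 := trunc_log_ltn (n j).+1 (isT : 1 < 2)%N.
move: l1 l2; rewrite -/(level i) -/(level j) lij expnS => l1 l2.
exfalso; move: l1 l2 g ni; move: (2 ^ _)%N (n i) (n j) => a b c.
by lia.
Qed.

(** Blocks without an order from the class [c] are filled with [2 ^ i] to get a total family. *)
Definition class_family (c i : nat) : nat :=
  if [pick j : 'I_J | (j %% M == c)%N && (level j == i)] is Some j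
  then (n j).+1 else (2 ^ i)%N.

Lemma class_family_dyadic c : dyadic_family (class_family c).
Proof.
move=> i; rewrite /class_family; case: pickP => [j /andP[_ /eqP <-]|_].
  by rewrite trunc_logP// trunc_log_ltn.
by rewrite leqnn ltn_exp2l/=.
Qed.

Lemma class_familyE (j : 'I_J) : class_family (j %% M)%N (level j) = (n j).+1.
Proof.
rewrite /class_family; case: pickP => [i /andP[/eqP ij /eqP lij]|/(_ j)].
  by rewrite (level_inj_mod ij lij).
by rewrite !eqxx.
Qed.

Lemma loglog_plus_le (a b : R) : 0 < a -> a <= b ->
  loglog_plus a <= loglog_plus b.
Proof.
move=> a0 ab; rewrite ler_ln ?posrE ?(lt_le_trans _ (log_plus_ge _))//.
rewrite lerD2l ge_max !le_max lexx/= ler_ln ?posrE ?ab ?orbT//.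
exact: lt_le_trans ab.
Qed.

Lemma discrete_lacunary_maximal N (f phi : seq bool -> R) (t : R) :
  (forall j, ((n j).+1 < 2 ^ N)%N) ->
  (forall x, size x = N -> `|f x| <= phi x <= 1) ->
  0 < avg N phi -> 0 < t <= 1 ->
  let s := 192 * M%:R * (avg N phi / t) * loglog_plus (t / avg N phi) in
  avg N (fun x => [exists j : 'I_J, s < `|psum N (n j).+1 f x|]%R%:R) <= t.
Proof.
move=> nN fphi P0 /andP[t0 t1]; set s := 192 * _ * _ * _; cbv zeta.
have M0R : 0 < M%:R :> R by rewrite ltr0n.
have M1R : 1 <= M%:R :> R by rewrite ler1n.
(* Each of the [M] classes is allowed an exceptional set of measure [t / M]; this costs a factor [M]
   in the threshold, [loglog_plus] being monotone. *)
pose t' := t / M%:R.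
have t'0 : 0 < t' by exact: divr_gt0.
have t't : t' <= t by rewrite ler_pdivrMr// ler_peMr// ltW.
have t'1 : 0 < t' <= 1 by rewrite t'0 (le_trans t't).
pose s' := 192 * (avg N phi / t') * loglog_plus (t' / avg N phi).
have s's : s' <= s.
  rewrite /s' /s (_ : 192 * (avg N phi / t') = 192 * M%:R * (avg N phi / t)).
    rewrite ler_wpM2l ?mulr_ge0 ?invr_ge0 ?(ltW t0) ?(ltW P0)//.
    by apply: loglog_plus_le; rewrite ?divr_gt0// ler_pM2r ?invr_gt0.
  by rewrite /t'; field; rewrite !gt_eqF.
apply: (@le_trans _ _ (\sum_(c < M) avg N (fun x =>
    [exists i : 'I_N, s' < `|psum N (class_family c i) f x|]%R%:R))).
  rewrite -avg_sum; apply: le_avg => x sx.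
  case: existsP => [[j sj]|_]; last by rewrite sumr_ge0.
  have cM : (j %% M < M)%N by rewrite ltn_mod.
  have lN : (level j < N)%N.
    rewrite -(ltn_exp2l _ _ (isT : 1 < 2)%N) (leq_ltn_trans _ (nN j))//.
    exact: trunc_logP.
  have ex : [exists i : 'I_N, s' < `|psum N (class_family (j %% M)%N i) f x|].
    apply/existsP; exists (Ordinal lN); rewrite /= class_familyE.
    exact: le_lt_trans sj.
  rewrite (bigD1 (Ordinal cM))//= ex.
  by rewrite lerDl sumr_ge0.
apply: (@le_trans _ _ (\sum_(c < M) t')); last first.
  by rewrite sumr_const card_ord -mulr_natr divfK// gt_eqF.
apply: ler_sum => c _.
exact: (@discrete_lacunary_bound _ N _ f phi t' (class_family_dyadic c)).
Qed.

End Lacunary.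

(* If |F| = 0, the right-hand side is C * (0 / t) * _ = 0. *)
Theorem lemma5p2 (R : realType) (alpha : R) (halpha : 1 < alpha) :
  exists C : R,
    forall (J : nat) (hJ : (0 < J)%N) (n : 'I_J -> nat)
      (hn : lacunary alpha n)
      (t : R) (ht : 0 < t)
      (F : set (lebesgueType R)) (mF : measurable F) (hF : F `<=` unit_itv R)
      (f : lebesgueType R -> R) (mf : measurable_fun (unit_itv R) f)
      (hf : majorized f F),
    let sF := fine (lebmeas R F) in
    (rearrangement (lac_maximal n f) t <=
      (C * (sF / t) * loglog_plus (t / sF))%:E)%E.
Proof.
have [M M0 alphaM] : exists2 M, (0 < M)%N & 4 <= alpha ^+ M.
  have la : 0 < ln alpha by rewrite ln_gt0.
  (* The power is the exponential of [M * ln alpha >= 3], hence at least [1 + 3]. *)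
  exists (Num.truncn (3 / ln alpha)).+1 => //.
  rewrite -[alpha]lnK ?posrE ?(lt_trans ltr01)// -expRM_natl.
  apply: le_trans (expR_ge1Dx _); rewrite lnK ?posrE ?(lt_trans ltr01)//.
  have : 3 / ln alpha <= (Num.truncn (3 / ln alpha)).+1%:R.
    by rewrite ltW// truncnS_gt.
  by rewrite ler_pdivrMr// => ?; lra.
exists (192 * M%:R) => J _ n hn t t0 F mF FI f mf hf; set sF := fine _; cbv zeta.
set s := 192 * M%:R * _ * _.
have sF0 : 0 <= sF by rewrite fine_ge0// outer_measure_ge0.
have s0 : 0 <= s.
  have ll := loglog_plus_ge1 (t / sF).
  by rewrite !mulr_ge0 ?invr_ge0 ?(ltW t0)//; lra.
apply: ereal_inf_lbound; exists s => //; split=> //.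
set B := [set x | _].
have BI : B `<=` unit_itv R by move=> y [].
(* The whole interval has measure 1, so only [t <= 1] needs the discrete bound. *)
have [t1|t1] := ltP 1 t.
  by apply: le_trans (le_lebmeas BI) _; rewrite lebmeas_unit_itv lee_fin ltW.
(* Fine enough to resolve all frequencies involved; the bounds do not depend on [N]. *)
pose N := (\sum_j n j).+2.
have nN j : ((n j).+1 < 2 ^ N)%N.
  apply: leq_trans (ltn_expl _ (isT : 1 < 2)%N); rewrite ltnS ltnW// ltnS.
  by rewrite (bigD1 j)//= leq_addr.
pose P x := [exists j : 'I_J, s < `|psum N (n j).+1 (dyadic_avg N f) x|].
apply: (@le_trans _ _ (avg N (fun x => (P x)%:R))%:E).
  apply: lebmeas_le_avg => // x y sx cy yx [_ sy].
  apply/existsP; move: sy; rewrite /lac_maximal ger0_norm; last first.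
    by rewrite bigmax_idl le_max lexx.
  apply: contraPP => /forallNP nP; apply/negP; rewrite -leNgt.
  apply/bigmax_leP; split=> // j _.
  rewrite (walsh_psum_dyadic mf hf _ (nN j) sx cy yx)// leNgt.
  by apply/negP; exact: nP.
rewrite lee_fin.
have bnd x : size x = N ->
    `|dyadic_avg N f x| <= dyadic_density N F x <= 1 by exact: dyadic_avg_le.
have dF := avg_dyadic_density N mF FI.
have [sF_gt0|sF_le0] := ltP 0 sF.
  have := discrete_lacunary_maximal halpha hn M0 alphaM nN bnd.
  by rewrite dF => /(_ t sF_gt0); apply; rewrite t0.
(* Here all dyadic Walsh coefficients vanish, and no partial sum exceeds the threshold 0. *)
have sFE : sF = 0 by apply/le_anti; rewrite sF_le0.
have s_eq0 : s = 0 by rewrite /s sFE mul0r mulr0 mul0r.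
suff -> : avg N (fun x => (P x)%:R) = 0 :> R by exact: ltW.
rewrite -[RHS](avg_cst N); apply: eq_avg => x sx.
have coef0 m : wcoef N (dyadic_avg N f) m = 0.
  apply/normr0_eq0/le_anti; rewrite normr_ge0 andbT -sFE /sF -dF.
  apply: le_trans (ler_norm_wcoef _ _ _) _.
  by apply: le_avg => z /bnd/andP[].
rewrite /P; case: existsP => // -[j]; rewrite s_eq0 normr_gt0 /psum big1 ?eqxx//.
by move=> k _; rewrite coef0 mul0r.
Qed.
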